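(* Let $a>0$, $\Omega=(-a,a)$, $K\in\mathcal{C}^{(n,n)}(\Omega\times\Omega)$, $x_1,\ldots,x_n\in\mathbb{R}$, and $\mathbf{K}_\varepsilon=[K(\varepsilon x_i,\varepsilon x_j)]_{i,j=1}^n$. Assume that for some $\varepsilon_0>0$, $\mathbf{K}_\varepsilon$ is symmetric positive semidefinite for all $\varepsilon\in[0,\varepsilon_0]$, and that $\varepsilon\mapsto\mathbf{K}_\varepsilon$ is analytic in a neighbourhood of $0$. Let $\lambda_1(\varepsilon)\ge\cdots\ge\lambda_n(\varepsilon)$ be its eigenvalues for small $\varepsilon>0$. Then for each $1\le s\le n$, \[\lambda_s(\varepsilon)=\varepsilon^{2(s-1)}\big(\widetilde{\lambda}_s+\mathcal{O}(\varepsilon)\big)\] for some real numbers $\widetilde\lambda_s$, and these satisfy \[\widetilde{\lambda}_1\cdots\widetilde{\lambda}_s=\det(\mathbf{V}_{\le s-1}^{\top}\mathbf{V}_{\le s-1})\,\det(\mathbf{W}_{s-1}),\qquad 1\le s\le n.\]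
   Context: $K\in\mathcal{C}^{(\ell,\ell)}(\Omega\times\Omega)$ means that all partial derivatives $K^{(i,j)}=\frac{\partial^{i+j}K}{\partial x^i\partial y^j}$ exist and are continuous on $\Omega\times\Omega$ for $0\le i,j\le\ell$. Wronskian: $\mathbf{W}_k=\Big[\frac{K^{(i,j)}(0,0)}{i!\,j!}\Big]_{i,j=0}^{k}$. Vandermonde: $\mathbf{V}_{\le k}=[x_i^{j}]_{1\le i\le n,\,0\le j\le k}\in\mathbb{R}^{n\times(k+1)}$. *)

(* Defs.v *)
From HB Require Import structures.
From mathcomp Require Import all_boot all_order all_algebra.
From mathcomp Require Import all_classical all_reals all_analysis.
Set Implicit Arguments. Unset Strict Implicit. Unset Printing Implicit Defensive.
Import Order.TTheory GRing.Theory Num.Theory.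
Import numFieldNormedType.Exports.
Local Open Scope classical_set_scope.
Local Open Scope ring_scope.

Section Defs.
Variable R : realType.

Definition Omega (a : R) : set R := [set x | -a < x < a].

Definition pderiv (K : R -> R -> R) (i j : nat) (x y : R) : R :=
  derive1n i (fun x' => derive1n j (K x') y) x.

Definition Cll (l : nat) (a : R) (K : R -> R -> R) : Prop :=
  [/\ (forall j : nat, (j < l)%N -> forall x y, Omega a x -> Omega a y ->
         derivable (derive1n j (K x)) y 1),
      (forall i j : nat, (i < l)%N -> (j <= l)%N -> forall x y,
         Omega a x -> Omega a y ->
         derivable (fun x' => pderiv K i j x' y) x 1) &
      (forall i j : nat, (i <= l)%N -> (j <= l)%N ->
         {within Omega a `*` Omega a,
            continuous (fun p : R * R => pderiv K i j p.1 p.2)})].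

Definition Keps (n : nat) (K : R -> R -> R) (x : 'I_n -> R) (e : R) : 'M[R]_n :=
  \matrix_(i, j) K (e * x i) (e * x j).

Definition psd (n : nat) (A : 'M[R]_n) : Prop :=
  A^T = A /\ forall v : 'cV[R]_n, 0 <= (v^T *m A *m v) 0 0.

Definition analytic_at0 (f : R -> R) : Prop :=
  exists r : R, 0 < r /\ exists c : nat -> R, forall e : R, `|e| < r ->
    (fun N : nat => \sum_(k < N) c k * e ^+ k) @ \oo --> f e.

Definition sorted_eigs (n : nat) (A : 'M[R]_n) (l : 'I_n -> R) : Prop :=
  char_poly A = \prod_(i < n) ('X - (l i)%:P) /\
  forall i j : 'I_n, (i <= j)%N -> l j <= l i.

Definition Wronskian (K : R -> R -> R) (k : nat) : 'M[R]_k.+1 :=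
  \matrix_(i, j) (pderiv K i j 0 0 / ((i`!)%:R * (j`!)%:R)).

Definition Vand (n : nat) (x : 'I_n -> R) (k : nat) : 'M[R]_(n, k.+1) :=
  \matrix_(i, j) (x i ^+ j).

End Defs.

(* Main.v *)
Require Import Defs.
From HB Require Import structures.
From mathcomp Require Import all_boot all_order all_algebra.
From mathcomp Require Import all_classical all_reals all_analysis.
From mathcomp Require Import perm zify ring lra.
Import Order.TTheory GRing.Theory Num.Theory.
Import numFieldNormedType.Exports.
Local Open Scope classical_set_scope.
Local Open Scope ring_scope.
Set Implicit Arguments. Unset Strict Implicit. Unset Printing Implicit Defensive.

(** The eigenvalues are not assumed to be analytic in the parameter, nor do the
    limits determine them when some [det W_s] vanishes, so a truncated form of
    Rellich's theorem is needed.  A symmetric polynomial matrix can be diagonalised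
    modulo any power of ['X] by polynomial matrices that are orthogonal up to a
    scalar: order by order, a Cayley rotation decouples diagonal entries that are
    already distinct and a constant orthogonal matrix treats the classes of entries
    that still agree.  With Weyl's inequality this gives every eigenvalue a Taylor
    expansion with an O(e^N) error.

    Let [P] be orthogonal with [P V] upper triangular ([V] the Vandermonde matrix)
    and let [B e = P K_e P^T].  Row [i] of [P] annihilates the powers below [i], so
    [B_ij e / e^(i + j)] tends to [r_i r_j W_ij], with [r] the diagonal of [P V].
    Courant-Fischer then shows that the expansion of [lambda_s] starts at order
    [2 s], and the product formula comes from the limit of suitably rescaled
    determinants [det (1 + e^-(2 s + 1) B e)]. *)

(** * Limits of finite sums, products and determinants *)

Section BigCvg.
Variables (R : realType) (T I : Type) (F : set_system T).
Context {FF : Filter F}.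

Lemma cvg_sum (r : seq I) (P : pred I) (f : I -> T -> R) (l : I -> R) :
  (forall i, f i x @[x --> F] --> l i) ->
  \sum_(i <- r | P i) f i x @[x --> F] --> \sum_(i <- r | P i) l i.
Proof.
move=> fl; elim: r => [|i r IH].
  by rewrite big_nil; under eq_fun do rewrite big_nil; exact: cvg_cst.
rewrite big_cons; under eq_fun do rewrite big_cons.
by case: (P i) => //; apply: cvgD.
Qed.

Lemma cvg_prod (r : seq I) (P : pred I) (f : I -> T -> R) (l : I -> R) :
  (forall i, f i x @[x --> F] --> l i) ->
  \prod_(i <- r | P i) f i x @[x --> F] --> \prod_(i <- r | P i) l i.
Proof.
move=> fl; elim: r => [|i r IH].
  by rewrite big_nil; under eq_fun do rewrite big_nil; exact: cvg_cst.
rewrite big_cons; under eq_fun do rewrite big_cons.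
by case: (P i) => //; apply: cvgM.
Qed.

End BigCvg.

Lemma cvg_det (R : realType) (T : Type) (F : set_system T) {FF : Filter F} n
    (A : T -> 'M[R]_n) (L : 'M[R]_n) :
  (forall i j, A x i j @[x --> F] --> L i j) -> \det (A x) @[x --> F] --> \det L.
Proof.
move=> AL; apply: cvg_sum => s; apply: cvgM; first exact: cvg_cst.
by apply: cvg_prod => i; exact: AL.
Qed.

(** * Spectral theorem respecting a partition of the indices *)

(** The rotation that diagonalises the symmetric matrix with rows [(a, b)] and [(b, d)] keeps its
    Frobenius norm, so the squares on the diagonal gain exactly [2 b^2]. *)
Lemma rotation_diag_increase (R : realType) (a b d : R) : b != 0 ->
  exists c s : R, c ^+ 2 + s ^+ 2 = 1 /\
    a ^+ 2 + d ^+ 2 <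
      (c ^+ 2 * a + 2 * (c * s * b) + s ^+ 2 * d) ^+ 2 +
      (s ^+ 2 * a - 2 * (c * s * b) + c ^+ 2 * d) ^+ 2.
Proof.
move=> b0.
have b2 : 0 < b ^+ 2 by rewrite exprn_even_gt0.
(* [r] is the gap between the eigenvalues [(a + d + r) / 2] and [(a + d - r) / 2]; the angle
   satisfies [cos (2 theta) = (a - d) / r] and [sin (2 theta) = 2 b / r]. *)
pose r := Num.sqrt ((a - d) ^+ 2 + 4 * b ^+ 2).
have r2 : r ^+ 2 = (a - d) ^+ 2 + 4 * b ^+ 2.
  by rewrite sqr_sqrtr // addr_ge0 ?sqr_ge0 // mulr_ge0 // sqr_ge0.
have r0 : 0 < r.
  by rewrite sqrtr_gt0 ltr_wpDl ?sqr_ge0 // mulr_gt0.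
have adr : - r < a - d.
  rewrite ltNge; apply/negP => h.
  have : r * r <= (d - a) * (d - a) by apply: ler_pM; lra.
  have -> : (d - a) * (d - a) = (a - d) ^+ 2 by ring.
  by rewrite -expr2 r2 gerDl leNgt mulr_gt0.
have c2 : 0 < (1 + (a - d) / r) / 2.
  by rewrite divr_gt0 // -[1](@divff _ r) ?gt_eqF // -mulrDl divr_gt0 //; lra.
pose c := Num.sqrt ((1 + (a - d) / r) / 2).
have cE : c ^+ 2 = (1 + (a - d) / r) / 2 by rewrite sqr_sqrtr // ltW.
have c0 : 0 < c by rewrite sqrtr_gt0.
pose s := b / r / c.
have scE : c * s = b / r by rewrite /s mulrC divfK // gt_eqF.
have c2E : c ^+ 2 = (r + a - d) / (2 * r).
  by rewrite cE; field; rewrite gt_eqF.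
have rad : r + a - d != 0 by rewrite gt_eqF //; lra.
have sE : s ^+ 2 = (r - a + d) / (2 * r).
  have -> : s ^+ 2 = (b ^+ 2) / r ^+ 2 / c ^+ 2 by rewrite /s !expr_div_n.
  have -> : b ^+ 2 = (r - a + d) * (r + a - d) / 4.
    have -> : (r - a + d) * (r + a - d) = r ^+ 2 - (a - d) ^+ 2 by ring.
    by rewrite r2; field.
  by rewrite c2E; field; rewrite rad gt_eqF.
exists c, s; split.
  by rewrite sE c2E; field; rewrite gt_eqF.
rewrite -mulrA in scE *.
have -> : c ^+ 2 * a + 2 * (c * (s * b)) + s ^+ 2 * d = (a + d) / 2 + r / 2.
  have -> : c * (s * b) = b ^+ 2 / r by rewrite mulrA scE; ring.
  have -> : b ^+ 2 = (r ^+ 2 - (a - d) ^+ 2) / 4 by rewrite r2; field.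
  by rewrite sE c2E; field; rewrite gt_eqF.
have -> : s ^+ 2 * a - 2 * (c * (s * b)) + c ^+ 2 * d = (a + d) / 2 - r / 2.
  have -> : c * (s * b) = b ^+ 2 / r by rewrite mulrA scE; ring.
  have -> : b ^+ 2 = (r ^+ 2 - (a - d) ^+ 2) / 4 by rewrite r2; field.
  by rewrite sE c2E; field; rewrite gt_eqF.
have -> : ((a + d) / 2 + r / 2) ^+ 2 + ((a + d) / 2 - r / 2) ^+ 2 =
    ((a + d) ^+ 2 + r ^+ 2) / 2 by field.
rewrite r2 ltr_pdivlMr // -subr_gt0.
have -> : (a + d) ^+ 2 + ((a - d) ^+ 2 + 4 * b ^+ 2) - (a ^+ 2 + d ^+ 2) * 2
  = 4 * b ^+ 2 by ring.
by rewrite mulr_gt0.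
Qed.

Definition rotation_mx (R : realType) n (i j : 'I_n) (c s : R) : 'M[R]_n :=
  \matrix_(k, l) if l == i then c * (k == i)%:R + s * (k == j)%:R
    else if l == j then c * (k == j)%:R - s * (k == i)%:R else (k == l)%:R.

Lemma mulmx_rotation (R : realType) m n (i j : 'I_n) (c s : R) (X : 'M[R]_(m, n)) k l :
  (X *m rotation_mx i j c s) k l =
    if l == i then c * X k i + s * X k j
    else if l == j then c * X k j - s * X k i else X k l.
Proof.
have sumE p (f : 'I_n -> R) : \sum_q f q * (q == p)%:R = f p.
  rewrite (bigD1 p) //= eqxx mulr1 big1 ?addr0 // => q /negbTE->.
  by rewrite mulr0.
rewrite mxE; under eq_bigr do rewrite mxE.
case: (l == i); last case: (l == j).
- under eq_bigr do rewrite mulrDr !(mulrCA (X k _)).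
  by rewrite big_split -!mulr_sumr !sumE.
- under eq_bigr do rewrite mulrBr !(mulrCA (X k _)).
  by rewrite sumrB -!mulr_sumr !sumE.
- exact: sumE.
Qed.

Lemma tr_rotation_mulmx (R : realType) m n (i j : 'I_n) (c s : R) (X : 'M[R]_(n, m)) k l :
  ((rotation_mx i j c s)^T *m X) k l =
    if k == i then c * X i l + s * X j l
    else if k == j then c * X j l - s * X i l else X k l.
Proof.
by rewrite -[X in _ *m X]trmxK -trmx_mul mxE mulmx_rotation !mxE.
Qed.

Lemma rotation_orthogonal (R : realType) n (i j : 'I_n) (c s : R) :
  i != j -> c ^+ 2 + s ^+ 2 = 1 ->
  (rotation_mx i j c s)^T *m rotation_mx i j c s = 1%:M.
Proof.
move=> ij cs; apply/matrixP => k l; rewrite tr_rotation_mulmx !mxE.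
have ji := ij; rewrite eq_sym in ji.
have [ki|ki] := eqVneq k i; have [li|li] := eqVneq l i.
- by rewrite ?ki ?li ?eqxx ?(negbTE ij) ?(negbTE ji) -[RHS]cs /= ?mulr1n; ring.
- have [lj|lj] := eqVneq l j; rewrite ?ki ?lj ?eqxx ?(negbTE ij) ?(negbTE ji).
    by rewrite /= ?mulr1n; ring.
  by rewrite [i == l]eq_sym (negbTE li) /= !mulr0 addr0.
- have [kj|kj] := eqVneq k j; rewrite ?kj ?li ?eqxx ?(negbTE ij) ?(negbTE ji).
    by rewrite /= ?mulr1n; ring.
  by rewrite ?(negbTE ki) /= !mulr0 addr0.
- have [kj|kj] := eqVneq k j; have [lj|lj] := eqVneq l j;
    rewrite ?kj ?lj ?eqxx ?(negbTE ij) ?(negbTE ji).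
  + by rewrite -[RHS]cs /= ?mulr1n; ring.
  + by rewrite [j == l]eq_sym (negbTE lj) /= !mulr0 subrr.
  + by rewrite ?(negbTE ki) ?(negbTE kj) /= !mulr0 subrr.
  + by [].
Qed.

(* Jacobi: among the orthogonal matrices respecting the classes of [c], a
   maximiser of the sum of the squared diagonal entries of [V^T B V] must make
   it diagonal, as otherwise a plane rotation would increase that sum. *)
Lemma spectral_block (R : realType) n (T : eqType) (c : 'I_n -> T) (B : 'M[R]_n) :
  B^T = B -> (forall i j, c i != c j -> B i j = 0) ->
  exists V : 'M[R]_n, [/\ V^T *m V = 1%:M,
    forall i j, c i != c j -> V i j = 0 &
    forall i j, i != j -> (V^T *m B *m V) i j = 0].
Proof.
move=> Bs Bc.
pose M (v : 'rV[R]_(n * n)) : 'M[R]_n := vec_mx v.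
have Mc i j : continuous (fun v => M v i j).
  move=> v; have -> : (fun v => M v i j) = fun v => v ord0 (mxvec_index i j).
    by apply/funext => w; rewrite /M mxE.
  exact: coord_continuous.
pose A := [set v | (M v)^T *m M v = 1%:M /\ forall i j, c i != c j -> M v i j = 0].
have Abnd : bounded_set A.
  exists 1; split=> // r r1 v [/matrixP vo _] /=.
  apply: (le_trans _ (ltW r1)); rewrite /Num.norm/= mx_normrE.
  apply: bigmax_le => // -[i0 q] _ /=; rewrite ord1.
  case/mxvec_indexP: q => i j.
  have : M v i j ^+ 2 <= 1.
    have h := vo j j; rewrite !mxE eqxx in h; rewrite -[leRHS]h.
    rewrite (bigD1 i) //= !mxE -expr2 lerDl sumr_ge0 // => k _.
    by rewrite !mxE -expr2 sqr_ge0.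
  by rewrite !mxE -[X in _ <= X](expr1n _ 2) -real_normK ?num_real // ler_sqr ?nnegrE.
have Acl : closed A.
  have -> : A = (\bigcap_(p in [set: 'I_n * 'I_n])
      [set v | \sum_k M v k p.1 * M v k p.2 = (p.1 == p.2)%:R]) `&`
     \bigcap_(p in [set p : 'I_n * 'I_n | c p.1 != c p.2])
      [set v | M v p.1 p.2 = 0].
    apply/seteqP; split => v /= [vo vc]; split.
    - move=> [i j] _ /=; have /matrixP/(_ i j) := vo; rewrite !mxE => <-.
      by apply: eq_bigr => k _; rewrite !mxE.
    - by move=> [i j] /= /vc.
    - apply/matrixP => i j; rewrite mxE -[RHS](_ : (i == j)%:R = _) ?mxE //.
      rewrite -(vo (i, j)) //=.
      by apply: eq_bigr => k _; rewrite !mxE.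
    - by move=> i j /(vc (i, j)).
  apply: closedI.
  - apply: closed_bigI => -[i j] _ /=.
    apply: (@closed_comp _ _ _ [set (i == j)%:R : R]); last exact: closed_eq.
    move=> v _ ; apply: (@cvg_sum R _ _ (nbhs v) (nbhs_filter v)) => k; apply: cvgM; exact: Mc.
  - apply: closed_bigI => -[i j] _ /=.
    apply: (@closed_comp _ _ _ [set (0 : R)]); last exact: closed_eq.
    by move=> v _; exact: Mc.
have Acpt := bounded_closed_compact Abnd Acl.
have A0 : A !=set0.
  exists (mxvec 1%:M); rewrite /A /= /M mxvecK trmx1 mulmx1; split=> // i j.
  by rewrite mxE; case: (eqVneq i j) => // ->; rewrite eqxx.
pose F v := \sum_i (((M v)^T *m B *m M v) i i) ^+ 2.
have Fc : continuous F.
  move=> v; apply: (@cvg_sum R _ _ (nbhs v) (nbhs_filter v)) => i.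
  have e w : ((M w)^T *m B *m M w) i i = \sum_k (\sum_l M w l i * B l k) * M w k i.
    rewrite mxE; apply: eq_bigr => k _; rewrite mxE; congr (_ * _).
    by apply: eq_bigr => l _; rewrite mxE.
  rewrite (_ : (fun w => _) = fun w => (\sum_k (\sum_l M w l i * B l k) * M w k i) ^+ 2);
    last by apply/funext => w; rewrite e.
  rewrite e; under eq_fun do rewrite expr2.
  rewrite expr2.
  have h : (\sum_k (\sum_l M w l i * B l k) * M w k i) @[w --> v] -->
     \sum_k (\sum_l M v l i * B l k) * M v k i.
    apply: (@cvg_sum R _ _ (nbhs v) (nbhs_filter v)) => k; apply: cvgM; last exact: Mc.
    apply: (@cvg_sum R _ _ (nbhs v) (nbhs_filter v)) => l; apply: cvgM; [exact: Mc|exact: cvg_cst].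
  exact: cvgM.
have [v Av vmax] := compact_EVT_max A0 Acpt (continuous_subspaceT Fc).
case: (set_mem Av) => vo vc.
exists (M v); split => // i j ij; apply/eqP/negP => /negP bij.
set D := (M v)^T *m B *m M v in bij.
have Ds : D^T = D by rewrite /D !trmx_mul trmxK Bs mulmxA.
(* [M v] and [B] both respect the classes, hence so does [D]: a nonzero entry [D i j] joins two
   indices of one class, and rotating their plane stays inside [A]. *)
have Dc : c i = c j.
  apply/eqP/negPn/negP => cij; move/eqP: bij; apply; rewrite /D.
  rewrite mxE big1 // => k _.
  have [ckj|/vc->] := eqVneq (c k) (c j); last by rewrite mulr0.
  rewrite mxE big1 ?mul0r // => l _; rewrite mxE.
  have [cli|/vc->] := eqVneq (c l) (c i); last by rewrite mul0r.
  by rewrite (Bc l k) ?mulr0 // cli ckj.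
have [cc [ss [cs1 lt]]] := rotation_diag_increase (D i i) (D j j) bij.
pose J := rotation_mx i j cc ss.
pose w := mxvec (M v *m J).
have Mw : M w = M v *m J by rewrite /M /w mxvecK.
have Aw : A w.
  rewrite /A /= Mw trmx_mul mulmxA -(mulmxA J^T) vo mulmx1.
  rewrite rotation_orthogonal //; split=> // k l ckl.
  rewrite mulmx_rotation; case: (eqVneq l i) => [li|_].
    by rewrite !vc ?mulr0 ?addr0 // -?Dc -li.
  case: (eqVneq l j) => [lj|_]; last exact: vc.
  by rewrite !vc ?mulr0 ?subrr // ?Dc -lj.
have /vmax : w \in A by exact: mem_set.
rewrite leNgt => /negP; apply.
have FE u : F u = ((M u)^T *m B *m M u) i i ^+ 2 + ((M u)^T *m B *m M u) j j ^+ 2 +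
   \sum_(k | (k != i) && (k != j)) ((M u)^T *m B *m M u) k k ^+ 2.
  rewrite /F (bigD1 i) //= (bigD1 j) /=; last by rewrite eq_sym.
  by rewrite addrA.
have DJ : (M w)^T *m B *m M w = J^T *m D *m J.
  by rewrite Mw trmx_mul /D !mulmxA.
rewrite !FE DJ -/D.
have DJE k l : (J^T *m D *m J) k l = if l == i then cc * (J^T *m D) k i + ss * (J^T *m D) k j
    else if l == j then cc * (J^T *m D) k j - ss * (J^T *m D) k i else (J^T *m D) k l.
  exact: mulmx_rotation.
have Dji : D j i = D i j by rewrite -[in LHS]Ds mxE.
rewrite !DJE !tr_rotation_mulmx !eqxx eq_sym (negbTE ij) Dji.
apply: ltr_leD.
  apply: (lt_le_trans lt); rewrite le_eqVlt; apply/orP; left; apply/eqP.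
  by congr (_ ^+ 2 + _ ^+ 2); ring.
rewrite le_eqVlt; apply/orP; left; apply/eqP; apply: eq_bigr => k /andP[ki kj].
by rewrite DJE (negbTE ki) (negbTE kj) tr_rotation_mulmx (negbTE ki) (negbTE kj).
Qed.

(** * Orthogonal triangularisation *)

Lemma dotv_gt0 (R : realDomainType) n (u : 'rV[R]_n) : u != 0 -> 0 < (u *m u^T) 0 0.
Proof.
move=> u0; rewrite lt_neqAle eq_sym; have e : (u *m u^T) 0 0 = \sum_i u 0 i ^+ 2.
  by rewrite mxE; apply: eq_bigr => i _; rewrite mxE.
rewrite e sumr_ge0 ?andbT => [|i _]; last exact: sqr_ge0.
apply: contra u0; rewrite psumr_eq0 => [/allP h|i _]; last exact: sqr_ge0.
apply/eqP/rowP => i; rewrite mxE; apply/eqP; rewrite -sqrf_eq0.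
by apply: h; rewrite mem_index_enum.
Qed.

(** The reflection in the hyperplane orthogonal to [v - |v| e_0] sends [v] to [|v| e_0]; when these
    two vectors coincide, the identity serves. *)
Lemma householder (R : rcfType) n (v : 'cV[R]_n.+1) :
  exists H : 'M[R]_n.+1, H^T *m H = 1%:M /\ forall i, i != 0 -> (H *m v) i 0 = 0.
Proof.
pose dot (x y : 'cV[R]_n.+1) := (x^T *m y) 0 0.
have dotE (x y : 'cV[R]_n.+1) : x^T *m y = (dot x y)%:M by exact: mx11_scalar.
have dotC x y : dot x y = dot y x.
  by rewrite /dot !mxE; apply: eq_bigr => i _; rewrite !mxE mulrC.
have dotB x y z : dot (x - y) z = dot x z - dot y z.
  by rewrite /dot linearB /= mulmxBl !mxE.
pose a := Num.sqrt (dot v v).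
have a2 : a ^+ 2 = dot v v.
  rewrite sqr_sqrtr // /dot mxE; apply: sumr_ge0 => i _.
  by rewrite mxE -expr2 sqr_ge0.
pose e : 'cV[R]_n.+1 := a *: delta_mx 0 0.
have ee : dot e e = a ^+ 2.
  rewrite /dot mxE (bigD1 0) //= big1 ?addr0 => [|i i0]; last first.
    by rewrite !mxE (negbTE i0) mulr0 mul0r.
  by rewrite !mxE !eqxx !mulr1.
pose w := v - e; pose q := dot w w.
have [q0|q0] := eqVneq q 0.
  have ve : v = e.
    apply/eqP; rewrite -subr_eq0; apply: contraT => w0.
    have := @dotv_gt0 _ _ w^T; rewrite trmxK -/(dot w w) -/q q0 ltxx; apply.
    by apply: contra w0 => /eqP/(congr1 trmx); rewrite trmxK trmx0 => <-.
  exists 1%:M; rewrite trmx1 mulmx1; split=> // i i0.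
  by rewrite mul1mx ve !mxE (negbTE i0) mulr0.
pose H := 1%:M - (2 / q) *: (w *m w^T).
have Hs : H^T = H.
  by rewrite /H linearB /= linearZ /= trmx_mul trmxK trmx1.
have Hv : H *m v = e.
  (* Since [v] and [e] have the same length, [|v - e|^2 = 2 <v - e, v>]. *)
  have qE : q = 2 * dot w v.
    by rewrite /q /w !dotB !(dotC _ (v - e)) !dotB ee (dotC e v) a2; ring.
  rewrite /H mulmxBl mul1mx -scalemxAl -mulmxA dotE mul_mx_scalar scalerA.
  have -> : 2 / q * dot w v = 1 by rewrite mulrAC -qE divff.
  by rewrite scale1r /w opprB addrC subrK.
exists H; split=> [|i i0]; last by rewrite Hv !mxE (negbTE i0) mulr0.
rewrite Hs /H mulmxBl mul1mx mulmxBr mulmx1.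
rewrite -scalemxAl -scalemxAr mulmxA -(mulmxA w w^T w) dotE -/q.
rewrite mul_mx_scalar -scalemxAl !scalerA -!scalerBl -addrA -opprD -scalerDl.
have -> : 2 / q + (2 / q - 2 / q * (2 / q * q)) = 0 by rewrite divfK //; ring.
by rewrite scale0r subr0.
Qed.

(** QR factorisation by induction on the size: a Householder reflection clears the first column
    below the diagonal, and the lower right block is triangularised recursively. *)
Lemma orthogonal_triangularize (R : rcfType) n (V : 'M[R]_n) :
  exists P : 'M[R]_n, P^T *m P = 1%:M /\ forall i j : 'I_n, (j < i)%N -> (P *m V) i j = 0.
Proof.
elim: n V => [|n IH] V.
  by exists 1%:M; rewrite trmx1 mulmx1; split=> // -[].
have [H [Ho Hv]] := householder (col 0 V).
pose W : 'M[R]_(1 + n) := H *m V.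
have [P' [P'o P't]] := IH (drsubmx W).
pose P1 : 'M[R]_(1 + n) := block_mx 1%:M 0 0 P'.
have P1o : P1^T *m P1 = 1%:M.
  rewrite /P1 tr_block_mx mulmx_block !trmx0 !trmx1 !mulmx0 !mul0mx !mulmx1.
  by rewrite P'o !addr0 add0r -scalar_mx_block.
exists (P1 *m (H : 'M[R]_(1 + n))); split.
  by rewrite trmx_mul mulmxA -(mulmxA H^T) P1o mulmx1.
have W0 : dlsubmx W = 0.
  apply/matrixP => k l; rewrite !mxE.
  apply: etrans (Hv (rshift 1 k : 'I_(1 + n)) _) => //; rewrite ord1 !mxE.
  by apply: eq_bigr => m _; rewrite !mxE; congr (_ * V _ _); apply: val_inj.
have PW : P1 *m (H : 'M[R]_(1 + n)) *m V =
    block_mx (ulsubmx W) (ursubmx W) 0 (P' *m drsubmx W).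
  rewrite -mulmxA; transitivity (P1 *m W) => //.
  rewrite -{1}[W]submxK W0 mulmx_block.
  by rewrite !mul0mx !mul1mx !addr0 !mulmx0 !add0r.
move=> i j ji; rewrite PW.
case: (split_ordP (i : 'I_(1 + n))) ji => k ->; case: (split_ordP (j : 'I_(1 + n))) => l ->.
- by rewrite /= !ord1.
- by rewrite /= ord1.
- by move=> _; apply: etrans (block_mxEdl _ _ _ _ _ _) _; rewrite mxE.
- by move=> kl; apply: etrans (block_mxEdr _ _ _ _ _ _) _; exact: P't.
Qed.

(** * Courant-Fischer bound *)

(* Courant-Fischer: the subspace [v_j = 0 (j < s)] meets the span of the first
   [s + 1] eigenvectors nontrivially. *)
Lemma eigenvalue_le (R : realFieldType) n (P : 'M[R]_n) (a : 'I_n -> R) (s : 'I_n) (t : R) :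
  P^T *m P = 1%:M -> (forall i j : 'I_n, (i <= j)%N -> a j <= a i) ->
  (forall u : 'rV[R]_n, (forall j : 'I_n, (j < s)%N -> u 0 j = 0) ->
    (u *m (P^T *m diag_mx (\row_i a i) *m P) *m u^T) 0 0 <= t * (u *m u^T) 0 0) ->
  a s <= t.
Proof.
move=> Po aS h.
(* A left kernel vector [u] of [M] is the vector sought: columns [j < s] force [u_j = 0], columns
   [j > s] force orthogonality to the eigenvector in row [j] of [P], and the zero column [s] makes
   [M] singular. *)
pose M : 'M[R]_n := \matrix_(i, j) if (j < s)%N then (i == j)%:R
  else if j == s then 0 else P j i.
have /det0P[u u0 uM] : \det M == 0.
  rewrite -det_tr (expand_det_row _ s) big1 // => j _.
  by rewrite !mxE ltnn eqxx mul0r.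
have uME j : \sum_k u 0 k * M k j = 0.
  by move/matrixP: uM => /(_ 0 j); rewrite !mxE.
pose y := u *m P^T.
have yE j : y 0 j = \sum_k u 0 k * P j k.
  by rewrite mxE; apply: eq_bigr => k _; rewrite mxE.
have y0 (j : 'I_n) : (s < j)%N -> y 0 j = 0.
  move=> sj; rewrite yE -[RHS](uME j); apply: eq_bigr => k _.
  by rewrite mxE ltnNge (ltnW sj) /= -val_eqE /= gtn_eqF.
have us (j : 'I_n) : (j < s)%N -> u 0 j = 0.
  move=> js; rewrite -[RHS](uME j) (bigD1 j) //= big1 ?addr0 => [|k /negbTE kj].
    by rewrite mxE js eqxx mulr1.
  by rewrite mxE js kj mulr0.
have uu := dotv_gt0 u0.
rewrite -(ler_pM2r uu); apply: le_trans (h u us).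
have -> : u *m u^T = y *m y^T.
  by rewrite /y trmx_mul trmxK mulmxA -(mulmxA u) Po mulmx1.
have -> : u *m (P^T *m diag_mx (\row_i a i) *m P) *m u^T =
   y *m diag_mx (\row_i a i) *m y^T.
  by rewrite /y trmx_mul trmxK !mulmxA.
clearbody y.
have -> : (y *m y^T) 0 0 = \sum_i y 0 i ^+ 2.
  by rewrite mxE; apply: eq_bigr => i _; rewrite mxE.
have -> : (y *m diag_mx (\row_i a i) *m y^T) 0 0 = \sum_i a i * y 0 i ^+ 2.
  rewrite mxE; apply: eq_bigr => i _; rewrite mul_mx_diag !mxE.
  by rewrite mulrAC mulrC -expr2.
rewrite mulr_sumr; apply: ler_sum => i _.
have [si|i_s] := ltnP s i; last by rewrite ler_wpM2r ?sqr_ge0 ?aS.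
by rewrite y0 // expr0n /= !mulr0.
Qed.

(** The spectral theorem, used with a single class, diagonalises [A] in some order. Both lists of
    eigenvalues factor the same characteristic polynomial, so they differ by a permutation, which is
    absorbed into [P]. *)
Lemma sorted_eigs_diagonalization (R : realType) n (A : 'M[R]_n) (l : 'I_n -> R) :
  A^T = A -> sorted_eigs A l ->
  exists P : 'M[R]_n, P^T *m P = 1%:M /\ A = P^T *m diag_mx (\row_i l i) *m P.
Proof.
move=> As [cpA _].
have [|V [Vo _ Vd]] := @spectral_block _ _ unit (fun=> tt) A As; first by [].
have Vo' := mulmx1C Vo.
set D := V^T *m A *m V in Vd.
have cpD : char_poly D = char_poly A.
  rewrite /char_poly /char_poly_mx /D.
  have -> : 'X%:M - map_mx polyC (V^T *m A *m V) =
     map_mx polyC V^T *m ('X%:M - map_mx polyC A) *m map_mx polyC V.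
    rewrite mulmxBr mulmxBl -!map_mxM; congr (_ - _).
    by rewrite scalar_mxC -mulmxA -map_mxM Vo map_mx1 mulmx1.
  by rewrite !det_mulmx mulrAC -det_mulmx -map_mxM Vo map_mx1 det1 mul1r.
have AE : A = V *m D *m V^T.
  by rewrite /D !mulmxA Vo' mul1mx -mulmxA Vo' mulmx1.
clearbody D.
have DE : D = diag_mx (\row_i D i i).
  by apply/matrixP => i j; rewrite !mxE; case: eqVneq => [->|/Vd].
have : \prod_(x <- [tuple l i | i < n]) ('X - x%:P) =
       \prod_(x <- [tuple D i i | i < n]) ('X - x%:P).
  rewrite !big_tuple; under eq_bigr do rewrite tnth_mktuple.
  under [RHS]eq_bigr do rewrite tnth_mktuple.
  rewrite -cpA -cpD char_poly_trig //.
  by have := diag_mx_is_trig (\row_i D i i); rewrite -DE.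
move=> /prod_XsubC_eq/tuple_permP[p pE].
have lE i : l i = D (p i) (p i).
  have -> : l i = nth 0 [tuple l j | j < n] i by rewrite -tnth_nth tnth_mktuple.
  by rewrite pE -tnth_nth !tnth_mktuple.
have pp : (perm_mx p)^T *m perm_mx p = 1%:M :> 'M[R]_n.
  by rewrite tr_perm_mx -perm_mxM mulVg perm_mx1.
exists (perm_mx p *m V^T); split.
  by rewrite trmx_mul trmxK mulmxA -(mulmxA V) pp mulmx1.
have -> : diag_mx (\row_i l i) = perm_mx p *m D *m (perm_mx p)^T.
  apply/matrixP => i j; rewrite tr_perm_mx -col_permE -row_permE !mxE lE.
  case: eqVneq => [->|ij]; first by rewrite mulr1n.
  by rewrite [RHS]Vd ?(inj_eq perm_inj).
rewrite trmx_mul trmxK !mulmxA -(mulmxA V) pp mulmx1.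
by rewrite -(mulmxA (V *m D)) pp mulmx1.
Qed.

(** * Polynomials modulo powers of the variable, Cayley rotations *)

Lemma dvdXnP (R : fieldType) N (p : {poly R}) :
  reflect (forall k, (k < N)%N -> p`_k = 0) ('X^N %| p).
Proof.
apply: (iffP (dvdpP _ _)) => [[q ->] k kN|p0]; first by rewrite coefMXn kN.
exists (drop_poly N p); rewrite -[LHS](poly_take_drop N) (_ : take_poly N p = 0) ?add0r //.
by apply/polyP => k; rewrite coef_take_poly coef0; case: ifP => // /p0.
Qed.

Lemma dvdX_horner0 (R : fieldType) (p : {poly R}) : ('X %| p) = (p.[0] == 0).
Proof. by rewrite -[X in X %| _]subr0 -polyC0 dvdp_XsubCl. Qed.

Lemma coprime_Xn (R : fieldType) N (p : {poly R}) : p.[0] != 0 -> coprimep 'X^N p.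
Proof.
move=> p0; apply: coprimep_expl.
by rewrite coprimep_sym -[X in coprimep _ X]subr0 -polyC0 coprimep_XsubC.
Qed.

Lemma poly_valuation (R : idomainType) (p : {poly R}) : p != 0 ->
  exists v q, p = q * 'X^v /\ q.[0] != 0.
Proof.
move=> p0; have [v [q q0 pE]] := multiplicity_XsubC p 0.
by exists v, q; rewrite p0 /= subr0 in q0 pE.
Qed.

(** With [d = h * 'X^v] and [h(0) != 0], necessarily [v < N], and a single monomial of degree
    [N - v] cancels the coefficient of [b] at ['X^N]; it is divisible by ['X] because [v < N]. *)
Lemma solve_scalar_sylvester (R : numFieldType) N (b d : {poly R}) :
  'X^N %| b -> ~~ ('X^N %| d) ->
  exists s, [/\ 'X %| s, 'X^N %| s * d & 'X^(N.+1) %| b - 2 * (s * d)].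
Proof.
move=> /dvdpP[b' ->] dN.
have d0 : d != 0 by apply: contra dN => /eqP ->; rewrite dvdp0.
have [v [h [dE h0]]] := poly_valuation d0.
have vN : (v < N)%N.
  rewrite ltnNge; apply: contra dN => Nv.
  by rewrite dE dvdp_mull // dvdp_exp2l.
exists ((b'.[0] / (2 * h.[0]))%:P * 'X^(N - v)).
have sdE : (b'.[0] / (2 * h.[0]))%:P * 'X^(N - v) * d =
   (b'.[0] / (2 * h.[0]))%:P * h * 'X^N.
  by rewrite dE mulrACA -exprD subnK // ltnW.
split.
- by rewrite dvdp_mull // -(subnSK vN) exprS dvdp_mulr.
- by rewrite sdE dvdp_mull.
- rewrite sdE mulrA -mulrBl exprSr mulrC dvdp_mul // dvdX_horner0.
  rewrite -polyC_natr !hornerE /=.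
  by apply/eqP; field; rewrite h0.
Qed.

Section Cayley.
Variables (R : fieldType) (n : nat) (S B : 'M[{poly R}]_n).
Hypotheses (Sskew : S^T = - S) (SX : forall i j, 'X %| S i j).

(** [U] is [g] times the Cayley transform [(1 - S) (1 + S)^-1]; the adjugate replaces the inverse so
    that all entries stay polynomial. *)
Let T := 1%:M + S.
Let Q := \adj T.
Let g := \det T.
Let U := (1%:M - S) *m Q.
Let ev0 (M : 'M[{poly R}]_n) : 'M[R]_n := map_mx (horner_eval 0) M.

Let TT : T^T = 1%:M - S. Proof. by rewrite /T linearD /= trmx1 Sskew. Qed.

Let comm_TT : T *m T^T = T^T *m T.
Proof. by rewrite TT /T mulmxBr mulmxBl mulmx1 mul1mx mulmxDl mulmxDr mul1mx mulmx1. Qed.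

Lemma cayley_orthogonal : U^T *m U = (g ^+ 2)%:M.
Proof.
rewrite /U -TT trmx_mul trmxK mulmxA -(mulmxA Q^T) comm_TT mulmxA -mulmxA.
transitivity ((T *m Q)^T *m (T *m Q)); first by rewrite trmx_mul !mulmxA.
by rewrite mul_mx_adj tr_scalar_mx -scalar_mxM expr2.
Qed.

Let S0 : ev0 S = 0.
Proof.
apply/matrixP => i j; rewrite !mxE; apply/eqP.
by rewrite /horner_eval -dvdX_horner0.
Qed.

Let T0 : ev0 T = 1%:M.
Proof. by rewrite /ev0 /T map_mxD -/(ev0 S) S0 addr0 map_scalar_mx rmorph1. Qed.

Lemma cayley_det0 : g.[0] = 1.
Proof. by rewrite -[LHS]/(horner_eval 0 g) -det_map_mx -/(ev0 T) T0 det1. Qed.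

Lemma cayley_adj0 : ev0 Q = 1%:M.
Proof.
rewrite /ev0 /Q map_mx_adj -/(ev0 T) T0.
by rewrite -[LHS]mul1mx mul_mx_adj det1.
Qed.

Lemma cayley_ev0 : ev0 U = 1%:M.
Proof. by rewrite /ev0 /U map_mxM -/(ev0 Q) cayley_adj0 map_mxB -/(ev0 S) S0 subr0 map_scalar_mx rmorph1 mulmx1. Qed.

(** To first order the Cayley transform is [1 - 2 S], which turns [B] into [B + 2 (S B - B S)]. This
    is the exact version of that expansion, cleared of denominators. *)
Lemma cayley_conj : g *: (U^T *m B *m U) =
  g ^+ 3 *: B + 2 *: (U^T *m Q *m (S *m B - B *m S) *m Q).
Proof.
have TQ : T *m Q = g%:M by exact: mul_mx_adj.
have QT : Q *m T = g%:M by exact: mul_adj_mx.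
have UE : U = 2 *: Q - g%:M.
  have E : 1%:M - S = 2 *: 1%:M - T.
    by rewrite /T scaler_nat mulr2n opprD addrA addrK.
  by rewrite -TQ /U E mulmxBl -scalemxAl mul1mx.
have comm : g *: (B *m Q - Q *m B) = Q *m (S *m B - B *m S) *m Q.
  have -> : S *m B - B *m S = T *m B - B *m T.
    by rewrite /T mulmxDl mulmxDr mul1mx mulmx1 opprD addrACA subrr add0r.
  rewrite mulmxBr mulmxBl !mulmxA QT -(mulmxA _ T) TQ scalerBr.
  by rewrite mul_scalar_mx mul_mx_scalar -scalemxAl.
have BU : g *: (B *m U) = g *: (U *m B) + 2 *: (Q *m (S *m B - B *m S) *m Q).
  have d : B *m U - U *m B = 2 *: (B *m Q - Q *m B).
    rewrite UE mulmxBr mulmxBl mul_mx_scalar mul_scalar_mx -scalemxAr -scalemxAl.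
    by rewrite opprB addrA subrK scalerBr.
  rewrite -comm -[in LHS](subrK (U *m B) (B *m U)) d scalerDr addrC.
  by rewrite !scalerA mulrC.
rewrite -mulmxA scalemxAr BU mulmxDr -!scalemxAr !mulmxA; congr (_ + _).
by rewrite -[X in _ *: (X *m B)]mulmxA -/U cayley_orthogonal mul_scalar_mx scalerA -exprS.
Qed.

End Cayley.

(** * Diagonalisation of symmetric polynomial matrices *)

(** Factors congruent to the identity modulo ['X] leave the term of order [N] alone: once ['X^N] is
    taken out of [E], the difference vanishes at 0. *)
Lemma dvdp_horner0_mulmx (R : fieldType) n N (A B E : 'M[{poly R}]_n) :
  map_mx (horner_eval 0) A = 1%:M -> map_mx (horner_eval 0) B = 1%:M ->
  (forall i j, 'X^N %| E i j) ->
  forall i j, 'X^(N.+1) %| (A *m E *m B - E) i j.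
Proof.
move=> A1 B1 EN i j.
pose E' := map_mx (drop_poly N) E.
have EE : E = 'X^N *: E'.
  apply/matrixP => k l; rewrite !mxE -[LHS](poly_take_drop N) mulrC.
  rewrite (_ : take_poly N _ = 0) ?add0r //.
  apply/polyP => q; rewrite coef_take_poly coef0; case: ifP => // qN.
  by have /dvdXnP -> := EN k l.
rewrite EE -scalemxAr -scalemxAl -scalerBr mxE exprSr dvdp_mul // dvdX_horner0.
have : map_mx (horner_eval 0) (A *m E' *m B - E') = 0.
  by rewrite map_mxB !map_mxM A1 B1 mul1mx mulmx1 subrr.
by move=> /matrixP/(_ i j); rewrite [LHS]mxE [RHS]mxE => /eqP.
Qed.

Section DiagonalizationStep.
Variables (R : realType) (n N : nat) (B : 'M[{poly R}]_n).
Hypotheses (Bsym : B^T = B) (Boff : forall i j, i != j -> 'X^N %| B i j).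

(* A Cayley rotation with generator [S], where [S i j] solves the equation
   [B i j = 2 * S i j * (B i i - B j j)] to leading order. *)
Lemma separate_diag :
  exists (U : 'M[{poly R}]_n) (g : {poly R}), [/\ U^T *m U = (g ^+ 2)%:M, g.[0] = 1,
    forall i j, i != j -> 'X^N %| (U^T *m B *m U) i j &
    forall i j, i != j ->
      ~~ ('X^N %| (U^T *m B *m U) i i - (U^T *m B *m U) j j) ->
      'X^(N.+1) %| (U^T *m B *m U) i j].
Proof.
pose d i j := B i i - B j j.
pose good i j s := [/\ 'X %| s, 'X^N %| s * d i j &
   i != j -> ~~ ('X^N %| d i j) -> 'X^(N.+1) %| B i j - 2 * (s * d i j)].
have exS i j : exists s, good i j s.
  have [ij|ij] := eqVneq i j.
    by exists 0; split; rewrite ?mul0r ?dvdp0 ?ij ?eqxx.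
  have [dN|dN] := boolP ('X^N %| d i j).
    by exists 0; split; rewrite ?mul0r ?dvdp0 ?dN.
  by have [s [? ? ?]] := solve_scalar_sylvester (Boff ij) dN; exists s.
pose s i j := sval (cid (exS i j)).
have sP i j : good i j (s i j) by rewrite /s; case: cid.
(* The chosen solutions are used above the diagonal and reflected with a sign below it, which makes
   [S] skew; the equation is compatible with this because [B] is symmetric and [d] antisymmetric. *)
pose S : 'M[{poly R}]_n := \matrix_(i, j)
  if (i < j)%N then s i j else if (j < i)%N then - s j i else 0.
have Bji i j : B j i = B i j by rewrite -[in LHS]Bsym mxE.
have Sgood i j : good i j (S i j).
  rewrite /S mxE; case: ltngtP => [//|ji|/val_inj ->]; last first.
    by split; rewrite ?mul0r ?dvdp0 ?eqxx.
  have [h1 h2 h3] := sP j i.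
  have dE : - s j i * d i j = s j i * d j i by rewrite mulNr -mulrN opprB.
  split; rewrite ?dvdpNr ?dE // => ij; rewrite -Bji => nd.
  by apply: h3; rewrite 1?eq_sym // -dvdpNr opprB.
have Sskew : S^T = - S.
  by apply/matrixP => i j; rewrite !mxE; case: ltngtP; rewrite ?opprK ?oppr0.
have SX i j : 'X %| S i j by case: (Sgood i j).
clearbody S.
pose Q := \adj (1%:M + S); pose g := \det (1%:M + S).
pose U := (1%:M - S) *m Q.
pose E := S *m B - B *m S.
have UU : U^T *m U = (g ^+ 2)%:M by exact: cayley_orthogonal.
have g0 : g.[0] = 1 by exact: cayley_det0.
have conj : g *: (U^T *m B *m U) = g ^+ 3 *: B + 2 *: (U^T *m Q *m E *m Q).
  exact: cayley_conj.
have U0 : map_mx (horner_eval 0) U = 1%:M by exact: cayley_ev0.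
have Q0 : map_mx (horner_eval 0) Q = 1%:M by exact: cayley_adj0.
have UQ0 : map_mx (horner_eval 0) (U^T *m Q) = 1%:M.
  by rewrite map_mxM Q0 -map_trmx U0 trmx1 mulmx1.
(* The diagonal of [B] contributes [- S i j * d i j] to the commutator; every other term pairs an
   off-diagonal entry of [B], divisible by ['X^N], with an entry of [S], divisible by ['X]. *)
have EE i j : 'X^(N.+1) %| E i j + S i j * d i j.
  have -> : E i j + S i j * d i j =
     \sum_(k | k != j) S i k * B k j - \sum_(k | k != i) B i k * S k j.
    rewrite /E !mxE (bigD1 j) //= [X in _ - X](bigD1 i) //= /d; ring.
  rewrite dvdp_sub //; apply: (big_ind (fun x => 'X^(N.+1) %| x)) => [|x y|k kj];
    rewrite ?dvdp0 //; try exact: dvdp_add.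
  - by rewrite exprS dvdp_mul // Boff.
  - by rewrite exprSr dvdp_mul // Boff // eq_sym.
have EN i j : 'X^N %| E i j.
  have [_ h _] := Sgood i j.
  by rewrite -(dvdp_addl _ h) (dvdp_trans _ (EE i j)) // dvdp_exp2l.
have FE := dvdp_horner0_mulmx UQ0 Q0 EN.
have conjE i j : g * (U^T *m B *m U) i j =
   g ^+ 3 * B i j + 2 * (U^T *m Q *m E *m Q) i j.
  by move/matrixP: conj => /(_ i j); rewrite !mxE.
clearbody E.
have subE (X Y : 'M[{poly R}]_n) i j : (X - Y) i j = X i j - Y i j.
  by rewrite !mxE.
have FN i j : 'X^N %| (U^T *m Q *m E *m Q) i j.
  rewrite -[X in _ %| X](subrK (E i j)) dvdp_add //.
  have -> : (U^T *m Q *m E *m Q) i j - E i j = (U^T *m Q *m E *m Q - E) i j.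
    by rewrite subE.
  by apply: dvdp_trans (FE i j); rewrite dvdp_exp2l.
have gN M p : ('X^M %| g * p) = ('X^M %| p).
  by rewrite Gauss_dvdpr // coprime_Xn // g0 oner_neq0.
have offN i j : i != j -> 'X^N %| (U^T *m B *m U) i j.
  by move=> ij; rewrite -gN conjE dvdp_add // dvdp_mull // Boff.
exists U, g; split => // i j ij nd.
(* Modulo ['X^N], differences of diagonal entries are only multiplied by [g^2], so entries separated
   after the rotation were already separated before it. *)
have dN : ~~ ('X^N %| d i j).
  apply: contra nd => dN; rewrite -gN mulrBr !conjE.
  rewrite opprD addrACA -!mulrBr dvdp_add // dvdp_mull // dvdp_sub //.
have [_ _ /(_ ij dN) h] := Sgood i j.
rewrite -gN conjE.
have -> : g ^+ 3 * B i j + 2 * (U^T *m Q *m E *m Q) i j =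
  (g ^+ 3 - 1) * B i j + (B i j - 2 * (S i j * d i j)) +
  2 * (E i j + S i j * d i j) + 2 * ((U^T *m Q *m E *m Q) i j - E i j) by ring.
have h1 : 'X^(N.+1) %| (g ^+ 3 - 1) * B i j.
  by rewrite exprS dvdp_mul ?Boff // dvdX_horner0 !hornerE g0 expr1n subrr.
have h2 : 'X^(N.+1) %| 2 * (E i j + S i j * d i j) by rewrite dvdp_mull.
have h3 : 'X^(N.+1) %| 2 * ((U^T *m Q *m E *m Q) i j - E i j).
  by rewrite dvdp_mull // -subE.
by do 3!apply: dvdp_add => //.
Qed.

(** Put two indices in one class when their diagonal entries agree modulo ['X^N]. Within a class [B]
    is scalar modulo ['X^N], so a constant orthogonal matrix respecting the classes creates no
    off-diagonal coefficient below ['X^N]; at ['X^N] it conjugates the symmetric matrix [B0], which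
    the block spectral theorem diagonalises. *)
Lemma diagonalize_classes :
  (forall i j, i != j -> ~~ ('X^N %| B i i - B j j) -> 'X^(N.+1) %| B i j) ->
  exists V : 'M[R]_n, V^T *m V = 1%:M /\
    let W := map_mx polyC V in forall i j, i != j -> 'X^(N.+1) %| (W^T *m B *m W) i j.
Proof.
move=> Bsep.
pose c i := take_poly N (B i i).
have cP i j : c i != c j -> ~~ ('X^N %| B i i - B j j).
  apply: contra => /dvdXnP h; apply/eqP/polyP => k.
  rewrite !coef_take_poly; case: ifP => // kN.
  by apply/eqP; rewrite -subr_eq0 -coefB h.
pose B0 : 'M[R]_n := \matrix_(i, j) (B i j)`_N.
have B0c i j : c i != c j -> B0 i j = 0.
  move=> cij; have ij : i != j by apply: contraNneq cij => ->.
  by rewrite mxE; have /dvdXnP -> := Bsep i j ij (cP _ _ cij).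
have B0s : B0^T = B0 by apply/matrixP => i j; rewrite !mxE -[in LHS]Bsym mxE.
have [V [Vo Vc Vd]] := spectral_block B0s B0c.
exists V; split=> // W i j ij; apply/dvdXnP => k; rewrite ltnS => kN.
have -> : ((W^T *m B *m W) i j)`_k = \sum_b (\sum_a V a i * (B a b)`_k) * V b j.
  rewrite mxE coef_sum; apply: eq_bigr => b _; rewrite !mxE coefMC coef_sum.
  by congr (_ * _); apply: eq_bigr => a _; rewrite !mxE coefCM.
move: kN; rewrite leq_eqVlt => /orP[/eqP->|kN].
  rewrite -[RHS](Vd i j ij) mxE; apply: eq_bigr => b _; rewrite mxE; congr (_ * _).
  by apply: eq_bigr => a _; rewrite !mxE.
have Bk a b : a != b -> (B a b)`_k = 0 by move=> /Boff/dvdXnP ->.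
have h b : (\sum_a V a i * (B a b)`_k) * V b j = (B i i)`_k * (V b i * V b j).
  rewrite (bigD1 b) //= big1 ?addr0 => [|a ab]; last by rewrite Bk ?mulr0.
  have [cbi|/Vc->] := eqVneq (c b) (c i); last by rewrite !mul0r mulr0.
  have := congr1 (fun p : {poly R} => p`_k) cbi; rewrite /c !coef_take_poly kN => ->.
  by rewrite mulrAC mulrC.
rewrite (eq_bigr _ (fun b _ => h b)) -mulr_sumr.
have := congr1 (fun M : 'M[R]_n => M i j) Vo; rewrite !mxE (negbTE ij).
under eq_bigr do rewrite mxE.
by move=> ->; rewrite mulr0.
Qed.

End DiagonalizationStep.

Lemma poly_mx_diagonalization (R : realType) n (A : 'M[{poly R}]_n) (N : nat) :
  A^T = A -> exists (U : 'M[{poly R}]_n) (g : {poly R}),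
    [/\ U^T *m U = (g ^+ 2)%:M, g.[0] = 1 &
        forall i j, i != j -> 'X^N %| (U^T *m A *m U) i j].
Proof.
move=> As; elim: N => [|N [U [g [Uo g0 Ud]]]].
  exists 1%:M, 1; rewrite trmx1 mulmx1 expr1n hornerC; split=> // i j _.
  by rewrite expr0 dvd1p.
have sym (M P : 'M[{poly R}]_n) : P^T = P -> (M^T *m P *m M)^T = M^T *m P *m M.
  by move=> Ps; rewrite !trmx_mul trmxK Ps mulmxA.
have [U1 [g1 [U1o g10 U1d U1s]]] := separate_diag (sym U A As) Ud.
have [V [Vo Vd]] := diagonalize_classes (sym U1 _ (sym U A As)) U1d U1s.
exists (U *m U1 *m map_mx polyC V), (g * g1); split.
- rewrite !trmx_mul !mulmxA -(mulmxA _ U^T) Uo mul_mx_scalar -!scalemxAl.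
  rewrite -(mulmxA _ U1^T) U1o mul_mx_scalar -scalemxAl map_trmx -map_mxM Vo.
  by rewrite map_mx1 scalerA scalemx1 exprMn.
- by rewrite hornerM g0 g10 mulr1.
- by move=> i j /Vd; rewrite !trmx_mul !mulmxA.
Qed.

(** * Taylor expansion of the kernel *)

Definition taylor_poly (R : realType) (s : nat) (c : nat -> R) : {poly R} :=
  \poly_(k < s.+1) (c k / k`!%:R).

Lemma deriv_taylor_poly (R : realType) s (c : nat -> R) :
  (taylor_poly s.+1 c)^`() = taylor_poly s (fun k => c k.+1).
Proof.
apply/polyP => k; rewrite coef_deriv !coef_poly ltnS; case: ifP => _; last by rewrite mul0rn.
rewrite -mulr_natr factS natrM.
have k0 : (k.+1%:R : R) != 0 by rewrite pnatr_eq0.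
have kf : (k`!%:R : R) != 0 by rewrite pnatr_eq0 -lt0n fact_gt0.
by field; rewrite kf addrC natr1.
Qed.

(* [c s] replaces the derivative of order [s], only known up to [d]. *)
Lemma taylor_poly_approx (R : realType) (s : nat) (F : nat -> R -> R) (c : nat -> R)
    (r d : R) :
  (forall k (z : R), (k < s)%N -> `|z| <= r -> is_derive z 1 (F k) (F k.+1 z)) ->
  (forall k, (k < s)%N -> c k = F k 0) ->
  (forall z, `|z| <= r -> `|F s z - c s| <= d) ->
  forall y, `|y| <= r -> `|F 0%N y - (taylor_poly s c).[y]| <= d * `|y| ^+ s.
Proof.
elim: s F c => [|s IH] F c dF cF Fs y yr.
  by rewrite /taylor_poly poly_def big_ord1 expr0 alg_polyC hornerC fact0 divr1 mulr1 Fs.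
(* [G] vanishes at 0, and its derivative [G'] is the same kind of remainder for the shifted family,
   bounded by induction. The mean value theorem then supplies one more factor [|y|]. *)
pose G z := F 0%N z - (taylor_poly s.+1 c).[z].
pose G' z := F 1%N z - (taylor_poly s (fun k => c k.+1)).[z].
have dG (z : R) : `|z| <= r -> is_derive z 1 G (G' z).
  move=> zr; rewrite /G' -deriv_taylor_poly.
  have ? := dF 0%N z (ltn0Sn _) zr.
  exact: is_deriveB.
have G'le z : `|z| <= r -> `|G' z| <= d * `|z| ^+ s.
  apply: (IH (fun k => F k.+1) (fun k => c k.+1)) => // k.
  - by move=> w ks; apply: dF.
  - by move=> ks; rewrite cF.
have G0 : G 0 = 0.
  rewrite /G horner_coef0 /taylor_poly coef_poly /= fact0 divr1 cF //.
  by rewrite subrr.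
have d0 : 0 <= d by apply: le_trans (Fs y yr); exact: normr_ge0.
rewrite -/(G y).
have Gc (a b : R) : (forall z, z \in `[a, b] -> `|z| <= r) -> {within `[a, b], continuous G}.
  move=> abr; apply: derivable_within_continuous => z zab.
  by have [] := dG z (abr z zab).
have [y0|y0] := leP 0 y.
  have Hr z : z \in `[0, y] -> `|z| <= `|y|.
    by rewrite in_itv /= => /andP[z0 zy]; rewrite !ger0_norm.
  have [||z zy] := @MVT_segment _ G G' 0 y y0.
  - move=> z zy; apply: dG; apply: le_trans yr; apply: Hr.
    by apply: subset_itv_oo_cc.
  - by apply: Gc => z /Hr zy; exact: le_trans yr.
  rewrite G0 !subr0 => ->; rewrite normrM exprSr mulrA ler_wpM2r //.
  apply: (le_trans (G'le _ (le_trans (Hr _ zy) yr))).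
  by rewrite ler_wpM2l // lerXn2r ?nnegrE // Hr.
have Hr z : z \in `[y, 0] -> `|z| <= `|y|.
  by rewrite in_itv /= => /andP[yz z0]; rewrite !ler0_norm ?lerN2 // ltW.
have [||z zy] := @MVT_segment _ G G' y 0 (ltW y0).
- move=> z zy; apply: dG; apply: le_trans yr; apply: Hr.
  by apply: subset_itv_oo_cc.
- by apply: Gc => z /Hr zy; exact: le_trans yr.
rewrite G0 !sub0r -[`|G y|]normrN => ->; rewrite normrM normrN exprSr mulrA ler_wpM2r //.
apply: (le_trans (G'le _ (le_trans (Hr _ zy) yr))).
by rewrite ler_wpM2l // lerXn2r ?nnegrE // Hr.
Qed.

(** The weights annihilate all terms below order [s]. *)
Lemma sum_taylor_poly (R : realType) n s (v x : 'I_n -> R) (c : nat -> R) (e : R) :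
  (forall k, (k < s)%N -> \sum_i v i * x i ^+ k = 0) ->
  \sum_i v i * (taylor_poly s c).[e * x i] =
    e ^+ s * (\sum_i v i * x i ^+ s) * c s / s`!%:R.
Proof.
move=> v0; under eq_bigr do rewrite horner_poly mulr_sumr.
rewrite exchange_big /= (bigD1 ord_max) //= [X in _ + X]big1 ?addr0 => [|k ks].
  transitivity (c s / s`!%:R * e ^+ s * \sum_i v i * x i ^+ s); last by ring.
  by rewrite mulr_sumr; apply: eq_bigr => i _; rewrite exprMn; ring.
have ks' : (k < s)%N by rewrite ltn_neqAle ks -ltnS ltn_ord.
transitivity (c k / k`!%:R * e ^+ k * \sum_i v i * x i ^+ k).
  by rewrite mulr_sumr; apply: eq_bigr => i _; rewrite exprMn; ring.
by rewrite v0 ?mulr0.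
Qed.

Lemma Cll_continuous (R : realType) l (a : R) K i j : 0 < a -> Cll l a K ->
  (i <= l)%N -> (j <= l)%N -> forall d : R, 0 < d ->
  exists r : R, [/\ 0 < r, r < a & forall X Y, `|X| <= r -> `|Y| <= r ->
     `|pderiv K i j X Y - pderiv K i j 0 0| <= d].
Proof.
move=> a0 [_ _ cK] il jl d d0.
have O0 : (Omega a `*` Omega a) (0, 0) by rewrite /Omega /= oppr_lt0 a0.
have := cK i j il jl (0, 0).
move=> /cvgrPdist_le/(_ d d0) h.
have : within (Omega a `*` Omega a)
    (fun B => nbhs ((0, 0) : R * R) B)
    [set p | `|pderiv K i j 0 0 - pderiv K i j p.1 p.2| <= d].
  by rewrite nbhs_subspace_in.
case/nbhs_ballP => r /= r0 hr.
pose q := Num.min (r / 2) (a / 2).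
have q0 : 0 < q by rewrite lt_min !divr_gt0.
have qa : q < a by rewrite gt_min orbC ltr_pdivrMr // mulr_natr mulr2n ltrDl a0.
have qr : q < r by rewrite gt_min ltr_pdivrMr // mulr_natr mulr2n ltrDl r0.
exists q; split => // X Y Xq Yq; rewrite distrC.
apply: (hr (X, Y)).
  by split; rewrite /ball /= sub0r normrN; exact: le_lt_trans qr.
have OO Z : `|Z| <= q -> Omega a Z.
  by move=> Zq; rewrite /Omega /= -ltr_norml; exact: le_lt_trans qa.
by split; apply: OO.
Qed.

Lemma Cll_is_derive_r (R : realType) l (a : R) K j (x y : R) : Cll l a K -> (j < l)%N ->
  Omega a x -> Omega a y -> is_derive y 1 (derive1n j (K x)) (derive1n j.+1 (K x) y).
Proof.
move=> [h _ _] jl xa ya; rewrite /derive1n iterS -/(derive1n j (K x)) derive1E.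
by apply: derivableP; apply: h.
Qed.

Lemma Cll_is_derive_l (R : realType) l (a : R) K i j (x y : R) : Cll l a K -> (i < l)%N ->
  (j <= l)%N -> Omega a x -> Omega a y ->
  is_derive x 1 (fun x' => pderiv K i j x' y) (pderiv K i.+1 j x y).
Proof.
move=> [_ h _] il jl xa ya.
rewrite /pderiv [in X in is_derive _ _ _ X]/derive1n iterS -/(derive1n i _) derive1E.
by apply: derivableP; apply: h.
Qed.

(* For weights annihilating low powers, the first nonvanishing Taylor term. The
   Taylor expansion is applied in [y], then in [x] to each [y]-derivative, so
   that no interchange of partial derivatives is needed. *)
Lemma mixed_taylor_approx (R : realType) l (a : R) K n (x v w : 'I_n -> R) s t :
  0 < a -> Cll l a K -> (s <= l)%N -> (t <= l)%N ->
  (forall k, (k < s)%N -> \sum_i v i * x i ^+ k = 0) ->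
  (forall k, (k < t)%N -> \sum_i w i * x i ^+ k = 0) ->
  forall d : R, 0 < d -> exists r : R, 0 < r /\ forall e, 0 < e < r ->
  `|\sum_j w j * (\sum_i v i * K (e * x i) (e * x j)) -
    e ^+ (s + t) * ((\sum_i v i * x i ^+ s) * (\sum_j w j * x j ^+ t) *
      (pderiv K s t 0 0 / (s`!%:R * t`!%:R)))| <= d * e ^+ (s + t).
Proof.
move=> a0 CK sl tl v0 w0 d d0.
pose P := pderiv K s t 0 0.
pose Cv := \sum_i `|v i| * `|x i| ^+ s; pose Cw := \sum_j `|w j| * `|x j| ^+ t.
have Cv0 : 0 <= Cv by apply: sumr_ge0 => i _; rewrite mulr_ge0 ?exprn_ge0.
have Cw0 : 0 <= Cw by apply: sumr_ge0 => i _; rewrite mulr_ge0 ?exprn_ge0.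
have C1 : 0 < Cv * Cw + 1 by rewrite ltr_wpDl // mulr_ge0.
(* The two expansions lose the factors [Cv] and [Cw]; adding 1 keeps the denominator positive. *)
pose eta := d / (Cv * Cw + 1).
have eta0 : 0 < eta by rewrite divr_gt0.
have [q [q0 qa hq]] := Cll_continuous a0 CK sl tl eta0.
have OO Z : `|Z| <= q -> Omega a Z.
  by move=> Zq; rewrite /Omega /= -ltr_norml; exact: le_lt_trans qa.
(* [e < q / m] keeps every [e * x i] within [q]; the added 1 keeps [m] positive. *)
pose m := 1 + \sum_i `|x i|.
have m1 : 0 < m by rewrite ltr_wpDr // sumr_ge0.
have xm i : `|x i| <= m.
  rewrite /m (bigD1 i) //= addrCA lerDl addr_ge0 // sumr_ge0 //.
exists (q / m); split; first by rewrite divr_gt0.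
move=> e /andP[e0 eq].
have exq i : `|e * x i| <= q.
  rewrite normrM (gtr0_norm e0); move: eq; rewrite ltr_pdivlMr // => /ltW.
  by apply: le_trans; rewrite ler_pM2l.
(* Expansion in the first variable of the derivative of order [t] in the second, uniformly in [Y].
   The top coefficient is frozen at its value [P] at the origin. *)
have stepA Y : `|Y| <= q ->
   `|\sum_i v i * derive1n t (K (e * x i)) Y
     - e ^+ s * (\sum_i v i * x i ^+ s) * P / s`!%:R| <= eta * Cv * e ^+ s.
  move=> Yq.
  pose F k X := pderiv K k t X Y.
  pose c k := if (k < s)%N then F k 0 else P.
  have cs : c s = P by rewrite /c ltnn.
  rewrite -cs -sum_taylor_poly // -sumrB.
  apply: (le_trans (ler_norm_sum _ _ _)).
  rewrite /Cv mulr_sumr mulr_suml; apply: ler_sum => i _.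
  rewrite -mulrBr normrM.
  have h : `|F 0%N (e * x i) - (taylor_poly s c).[e * x i]| <= eta * `|e * x i| ^+ s.
    apply: (@taylor_poly_approx _ s F c q eta).
    - move=> k z ks zq; apply: (Cll_is_derive_l CK).
      + exact: leq_trans sl.
      + exact: tl.
      + exact: OO.
      + exact: OO.
    - by move=> k ks; rewrite /c ks.
    - by move=> z zq; rewrite cs; apply: hq.
    - exact: exq.
  apply: le_trans (_ : `|v i| * (eta * `|e * x i| ^+ s) <= _).
    by rewrite ler_wpM2l.
  by rewrite normrM (gtr0_norm e0) exprMn le_eqVlt; apply/orP; left; apply/eqP; ring.
pose G k Y := \sum_i v i * derive1n k (K (e * x i)) Y.
(* Expansion in the second variable: below order [t] the actual derivatives at 0 are used, since [w]
   annihilates those terms; the top coefficient is the main term found in [stepA]. *)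
pose b k := if (k < t)%N then G k 0 else e ^+ s * (\sum_i v i * x i ^+ s) * P / s`!%:R.
have bt : b t = e ^+ s * (\sum_i v i * x i ^+ s) * P / s`!%:R by rewrite /b ltnn.
have stepB j : `|G 0%N (e * x j) - (taylor_poly t b).[e * x j]| <=
    eta * Cv * e ^+ s * `|e * x j| ^+ t.
  apply: (@taylor_poly_approx _ t G b q).
  - move=> k z kt zq; rewrite /G.
    have -> : (fun Y => \sum_i v i * derive1n k (K (e * x i)) Y) =
      \sum_i (v i \*: derive1n k (K (e * x i))).
      by apply/funext => Y; rewrite fct_sumE.
    apply: is_derive_sum => i.
    apply: is_deriveZ.
    by apply: (Cll_is_derive_r CK); [exact: leq_trans tl|exact: OO|exact: OO].
  - by move=> k kt; rewrite /b kt.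
  - by move=> z zq; rewrite bt; apply: stepA.
  - exact: exq.
have -> : e ^+ (s + t) * ((\sum_i v i * x i ^+ s) * (\sum_j w j * x j ^+ t) *
      (P / (s`!%:R * t`!%:R))) = \sum_j w j * (taylor_poly t b).[e * x j].
  rewrite sum_taylor_poly // bt exprD invfM; ring.
rewrite -sumrB; apply: (le_trans (ler_norm_sum _ _ _)).
apply: (@le_trans _ _ (eta * (Cv * Cw) * e ^+ (s + t))).
  rewrite /Cw mulr_sumr mulr_sumr mulr_suml; apply: ler_sum => j _.
  rewrite -mulrBr normrM.
  apply: le_trans (_ : `|w j| * (eta * Cv * e ^+ s * `|e * x j| ^+ t) <= _).
    by rewrite ler_wpM2l //; exact: stepB.
  by rewrite normrM (gtr0_norm e0) exprMn exprD le_eqVlt; apply/orP; left; apply/eqP; ring.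
apply: ler_wpM2r; first by rewrite exprn_ge0 // ltW.
by rewrite /eta mulrAC ler_pdivrMr // mulrDr mulr1 lerDl ltW.
Qed.

(** * Polynomials and analytic functions near the origin *)

Lemma poly_bounded (R : realFieldType) (p : {poly R}) :
  exists C : R, 0 <= C /\ forall e, 0 <= e <= 1 -> `|p.[e]| <= C.
Proof.
exists (\sum_(i < size p) `|p`_i|); split=> [|e /andP[e0 e1]]; first exact: sumr_ge0.
rewrite horner_coef; apply: (le_trans (ler_norm_sum _ _ _)).
apply: ler_sum => i _; rewrite normrM ler_piMr // ger0_norm ?exprn_ge0 //.
exact: exprn_ile1.
Qed.

Lemma poly_near0 (R : realFieldType) (p : {poly R}) (d : R) : 0 < d ->
  exists r : R, 0 < r /\ forall e, 0 <= e < r -> `|p.[e] - p.[0]| <= d.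
Proof.
move=> d0.
have [q pE] : exists q, p - (p.[0])%:P = q * 'X.
  have /dvdpP[q qE] : 'X %| p - (p.[0])%:P by rewrite dvdX_horner0 !hornerE subrr.
  by exists q.
have [C [C0 hC]] := poly_bounded q.
exists (Num.min 1 (d / (C + 1))); split.
  by rewrite lt_min ltr01 divr_gt0 // ltr_wpDl.
move=> e /andP[e0]; rewrite lt_min => /andP[e1 ed].
have -> : p.[e] - p.[0] = q.[e] * e.
  by have := congr1 (fun p => p.[e]) pE; rewrite !hornerE.
rewrite normrM (ger0_norm e0).
have h := hC e; rewrite e0 (ltW e1) in h.
apply: (le_trans (ler_wpM2r e0 (h isT))).
move: ed; rewrite ltr_pdivlMr ?ltr_wpDl // => /ltW; apply: le_trans.
by rewrite mulrC ler_wpM2l // lerDl.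
Qed.

(** The sign is that of the lowest nonzero coefficient. Applied to differences, this makes
    polynomials comparable on some interval to the right of 0. *)
Lemma poly_sign_near0 (R : realFieldType) (p : {poly R}) :
  exists r : R, 0 < r /\
   ((forall e, 0 < e < r -> 0 <= p.[e]) \/ (forall e, 0 < e < r -> p.[e] < 0)).
Proof.
have [->|p0] := eqVneq p 0.
  by exists 1; split=> //; left => e _; rewrite horner0.
have [v [q [-> q0]]] := poly_valuation p0.
have [|r [r0 hr]] := @poly_near0 _ q (`|q.[0]| / 2).
  by rewrite divr_gt0 // normr_gt0.
exists r; split=> //.
move: q0; rewrite neq_lt => /orP[q0|q0]; [right|left] => e /andP[e0 er];
  have := hr e; rewrite (ltW e0) er hornerM hornerXn => /(_ isT).
- rewrite (ltr0_norm q0) ler_norml => /andP[_ h].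
  by rewrite nmulr_rlt0 ?exprn_gt0 //; lra.
- rewrite (gtr0_norm q0) ler_norml => /andP[h _].
  by rewrite mulr_ge0 ?exprn_ge0 ?(ltW e0) //; lra.
Qed.

Lemma poly_dvdX_of_bound (R : realFieldType) (p : {poly R}) N (C r : R) : 0 < r ->
  (forall e, 0 < e < r -> `|p.[e]| <= C * e ^+ N) -> 'X^N %| p.
Proof.
move=> r0 h.
have [->|p0] := eqVneq p 0; first exact: dvdp0.
have [v [q [pE q0]]] := poly_valuation p0.
rewrite pE; have [Nv|vN] := leqP N v; first by rewrite dvdp_mull // dvdp_exp2l.
exfalso.
have [|r' [r'0 hr']] := @poly_near0 _ q (`|q.[0]| / 2).
  by rewrite divr_gt0 // normr_gt0.
have q0' : 0 < `|q.[0]| by rewrite normr_gt0.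
(* If [v < N], the bound at this [e] gives [|q(e)| <= |C| e <= |q(0)| / 4], while [e < r'] keeps
   [|q(e)|] at least [|q(0)| / 2]. *)
pose e := Num.min (Num.min (r / 2) (r' / 2)) (Num.min 1 (`|q.[0]| / (4 * (`|C| + 1)))).
have C1 : 0 < `|C| + 1 by rewrite ltr_wpDl.
have e0 : 0 < e by rewrite !lt_min !divr_gt0 //= ?ltr01 ?mulr_gt0.
have [er er'] : e < r /\ e < r'.
  by split; rewrite !gt_min; [have -> : r / 2 < r|have -> : r' / 2 < r'];
    rewrite ?orbT ?ltr_pdivrMr // mulr_natr mulr2n ltrDl.
have e1 : e <= 1 by rewrite !ge_min lexx !orbT.
have eC : e <= `|q.[0]| / (4 * (`|C| + 1)) by rewrite !ge_min lexx !orbT.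
have := h e; rewrite e0 er => /(_ isT).
rewrite pE hornerM hornerXn normrM (ger0_norm (exprn_ge0 _ (ltW e0))).
rewrite -(subnKC (ltnW vN)) exprD mulrCA mulrC ler_pM2l ?exprn_gt0 // -(subnSK vN) exprS => qe.
have {}qe : `|q.[e]| <= `|q.[0]| / 4.
  apply: (le_trans qe); apply: (@le_trans _ _ (`|C| * e)).
    rewrite mulrA; apply: (@le_trans _ _ (`|C| * e * e ^+ (N - v.+1))).
      by rewrite ler_wpM2r ?exprn_ge0 ?(ltW e0) // ler_wpM2r ?ler_norm // ltW.
    by rewrite ler_piMr ?mulr_ge0 ?(ltW e0) // exprn_ile1 // ltW.
  have : e * (4 * (`|C| + 1)) <= `|q.[0]| by rewrite -ler_pdivlMr // mulr_gt0.
  have : 0 <= `|C| by []. nra.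
have := hr' e; rewrite (ltW e0) er' => /(_ isT).
rewrite distrC => q1.
have := lerB_dist q.[0] q.[e]; lra.
Qed.

(** Convergence at [q = r / 2] makes the terms [c k * q^k] bounded, whence the Cauchy estimate
    [|c k| <= M / q^k]. For [|e| < q / 2] the tail from order [N] is dominated by a geometric series
    of ratio 1/2. *)
Lemma analytic_trunc (R : realType) (f : R -> R) N : analytic_at0 f ->
  exists (p : {poly R}) (C r : R), [/\ 0 < r, 0 <= C &
    forall e, `|e| < r -> `|f e - p.[e]| <= C * `|e| ^+ N].
Proof.
move=> [r [r0 [c hc]]].
pose q := r / 2.
have q0 : 0 < q by rewrite divr_gt0.
have qr : `|q| < r by rewrite gtr0_norm // ltr_pdivrMr // mulr_natr mulr2n ltrDl.
have [M [M0 cM]] : exists M : R, 0 <= M /\ forall k, `|c k| <= M / q ^+ k.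
  have cv := hc q qr.
  have : cvgn (series (fun k => c k * q ^+ k)).
    rewrite /series /=; apply/cvg_ex; exists (f q).
    by under eq_fun do rewrite big_mkord.
  move=> /cvg_series_cvg_0 c0.
  have [M [_ hM]] := cvg_seq_bounded (cvgP _ c0).
  have hM' := hM (`|M| + 1).
  exists (`|M| + 1); split; first by rewrite addr_ge0.
  move=> k; rewrite ler_pdivlMr ?exprn_gt0 //.
  rewrite -[q ^+ k]ger0_norm ?exprn_ge0 ?(ltW q0) // -normrM.
  apply: (hM' _ k I); apply: le_lt_trans (ler_norm _) _.
  by rewrite ltrDl.
exists (\poly_(k < N) c k), (2 * M / q ^+ N), (q / 2); split.
- by rewrite divr_gt0.
- by rewrite divr_ge0 ?mulr_ge0 ?exprn_ge0 // ltW.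
move=> e eq.
have er : `|e| < r.
  by apply: lt_trans qr; apply: (lt_trans eq); rewrite (gtr0_norm q0) ltr_pdivrMr // mulr_natr mulr2n ltrDl.
have cv := hc e er.
pose t := `|e| / q.
have t0 : 0 <= t by rewrite divr_ge0 // ltW.
have t2 : t <= 1 / 2.
  by rewrite ler_pdivrMr // mulrC mulrA mulr1 ltW.
have tail m : `|\sum_(k < N + m) c k * e ^+ k - (\poly_(k < N) c k).[e]| <= 2 * M * t ^+ N.
  rewrite horner_poly big_split_ord /= addrAC subrr add0r.
  apply: (le_trans (ler_norm_sum _ _ _)).
  apply: (@le_trans _ _ (\sum_(i < m) M * t ^+ N * (1 / 2) ^+ i)).
    apply: ler_sum => i _; rewrite normrM normrX.
    apply: (@le_trans _ _ (M / q ^+ (N + i) * `|e| ^+ (N + i))).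
      by rewrite ler_wpM2r ?exprn_ge0.
    rewrite mulrAC -mulrA -expr_div_n -/t exprD mulrA ler_wpM2l //.
      by rewrite mulr_ge0 ?exprn_ge0.
    by rewrite lerXn2r ?nnegrE.
  rewrite -mulr_sumr [2 * M]mulrC -!mulrA ler_wpM2l // mulrC ler_wpM2r ?exprn_ge0 //.
  have : \sum_(i < m) (1 / 2 : R) ^+ i = 2 - 2 * (1 / 2) ^+ m.
    elim: m => [|m IH]; first by rewrite big_ord0 expr0 mulr1 subrr.
    by rewrite big_ord_recr /= IH exprS; field.
  by move=> ->; rewrite lerBlDr lerDl mulr_ge0 ?exprn_ge0.
have -> : 2 * M / q ^+ N * `|e| ^+ N = 2 * M * t ^+ N.
  by rewrite /t [in RHS]expr_div_n mulrA mulrAC.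
have cvN : (fun m => \sum_(k < N + m) c k * e ^+ k - (\poly_(k < N) c k).[e]) @ \oo -->
   f e - (\poly_(k < N) c k).[e].
  apply: cvgB; last exact: cvg_cst.
  have := cv; rewrite -(cvg_shiftn N) /=.
  by under eq_fun do rewrite addnC.
have cvn := @cvg_norm _ _ _ _ eventually_filter _ _ cvN.
rewrite -(cvg_lim (@Rhausdorff R) cvn); apply: limr_le; first exact: cvgP cvn.
by apply: nearW => m; exact: tail.
Qed.

(** * Determinants of leading blocks *)

Lemma det_lid_cols (R : comNzRingType) m k (N : 'M[R]_(m + k)) :
  (forall i (j : 'I_k), N i (rshift m j) = (i == rshift m j)%:R) ->
  \det N = \det (ulsubmx N).
Proof.
move=> h; rewrite -[N in LHS]submxK.
have -> : ursubmx N = 0.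
  apply/matrixP => i j; rewrite !mxE h.
  by case: eqP => // /(congr1 val) /= e; have := ltn_ord i; rewrite e ltnNge leq_addr.
have -> : drsubmx N = 1%:M.
  by apply/matrixP => i j; rewrite !mxE h (inj_eq (@rshift_inj _ _)).
by rewrite det_lblock det1 mulr1.
Qed.

Lemma det_leading (R : comNzRingType) n (s : 'I_n) (N : 'M[R]_n) (B : 'M[R]_s.+1) :
  (forall i j : 'I_n, (s < j)%N -> N i j = (i == j)%:R) ->
  (forall (i j : 'I_n) (i' j' : 'I_s.+1), i = i' :> nat -> j = j' :> nat -> N i j = B i' j') ->
  \det N = \det B.
Proof.
case: s B => s sn B; rewrite /= in B *.
have [k nE] : exists k, n = (s.+1 + k)%N by exists (n - s.+1)%N; rewrite subnKC.
move: sn N; rewrite nE => sn N h1 h2.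
rewrite (@det_lid_cols _ s.+1 k N) => [|i j]; last by rewrite h1 //= ltnS leq_addr.
by congr (\det _); apply/matrixP => i j; rewrite !mxE; apply: h2.
Qed.

(** The rows of [T] beyond [s] vanish, so the Gram matrix is that of the leading square block, which
    is upper triangular with diagonal [r]. *)
Lemma det_gram_triangular (R : comNzRingType) n (s : 'I_n) (T : 'M[R]_(n, s.+1)) (r : 'I_n -> R) :
  (forall (i : 'I_n) (j : 'I_s.+1), (j < i)%N -> T i j = 0) ->
  (forall (i : 'I_n) (j : 'I_s.+1), i = j :> nat -> T i j = r i) ->
  \det (T^T *m T) = (\prod_(i < n | (i <= s)%N) r i) ^+ 2.
Proof.
case: s T => s sn T; rewrite /= in T *.
have [k nE] : exists k, n = (s.+1 + k)%N by exists (n - s.+1)%N; rewrite subnKC.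
move: sn T r; rewrite nE => sn T r h hr.
rewrite -[T]vsubmxK.
have -> : dsubmx T = 0.
  by apply/matrixP => i j; rewrite !mxE h //= ltn_addr.
rewrite tr_col_mx mul_row_col trmx0 mul0mx addr0 det_mulmx det_tr -expr2; congr (_ ^+ 2).
rewrite -det_tr det_trig; last first.
  by apply/is_trig_mxP => i j ij; rewrite !mxE h.
rewrite [RHS]big_split_ord /= [X in _ * X]big1 ?mulr1 => [|i]; last first.
  by rewrite leqNgt /= ltnS leq_addr.
apply: eq_big => [i|i _]; first by rewrite /= -ltnS ltn_ord.
by rewrite !mxE; apply: hr.
Qed.

Lemma prod_leq_ord (R : comNzRingType) n (s : 'I_n) (f : 'I_n -> R) (g : 'I_s.+1 -> R) :
  (forall (i : 'I_n) (j : 'I_s.+1), i = j :> nat -> f i = g j) ->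
  \prod_(i < n | (i <= s)%N) f i = \prod_j g j.
Proof.
case: s g => s sn g; rewrite /= in g *.
have [k nE] : exists k, n = (s.+1 + k)%N by exists (n - s.+1)%N; rewrite subnKC.
move: sn f; rewrite nE => sn f h.
rewrite big_split_ord /= [X in _ * X]big1 ?mulr1 => [|i]; last first.
  by rewrite leqNgt /= ltnS leq_addr.
by apply: eq_big => [i|i _]; [rewrite /= -ltnS ltn_ord | apply: h].
Qed.

(** * Weyl's inequality *)

Lemma quad_form_bound (R : realFieldType) n (E : 'M[R]_n) (c : R) (u : 'rV[R]_n) :
  (forall i j, `|E i j| <= c) -> `|(u *m E *m u^T) 0 0| <= n%:R ^+ 2 * c * (u *m u^T) 0 0.
Proof.
move=> Ec.
have uuE : (u *m u^T) 0 0 = \sum_i u 0 i ^+ 2.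
  by rewrite mxE; apply: eq_bigr => i _; rewrite mxE.
have ule i j : `|u 0 i| * `|u 0 j| <= (u *m u^T) 0 0.
  have sqle k : `|u 0 k| ^+ 2 <= (u *m u^T) 0 0.
    rewrite uuE (bigD1 k) //= real_normK ?num_real // lerDl sumr_ge0 // => l _.
    exact: sqr_ge0.
  have := sqle i; have := sqle j; have := sqr_ge0 (`|u 0 i| - `|u 0 j|); nra.
have -> : (u *m E *m u^T) 0 0 = \sum_j \sum_i u 0 i * E i j * u 0 j.
  rewrite mxE; apply: eq_bigr => j _; rewrite !mxE mulr_suml.
  by apply: eq_bigr.
apply: (le_trans (ler_norm_sum _ _ _)).
apply: (@le_trans _ _ (\sum_(j < n) \sum_(i < n) c * (u *m u^T) 0 0)).
  apply: ler_sum => j _; apply: (le_trans (ler_norm_sum _ _ _)).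
  apply: ler_sum => i _; rewrite !normrM mulrAC mulrC.
  apply: ler_pM => //; exact: mulr_ge0.
by rewrite !sumr_const !card_ord -mulrnA -[leLHS]mulr_natl natrM expr2 -!mulrA.
Qed.

(** Both inequalities come from Courant-Fischer. On vectors whose first [s] coordinates vanish, a
    decreasing diagonal form is at most its entry at [s], and the perturbation [E] adds at most
    [n^2 c]; the lower bound exchanges the roles of [a] and [b] by conjugating with [P]. *)
Lemma weyl_diag (R : realFieldType) n (P : 'M[R]_n) (a b : 'I_n -> R) (c : R) :
  P^T *m P = 1%:M ->
  (forall i j : 'I_n, (i <= j)%N -> a j <= a i) ->
  (forall i j : 'I_n, (i <= j)%N -> b j <= b i) ->
  (forall i j, `|(P^T *m diag_mx (\row_i a i) *m P) i j - (i == j)%:R * b i| <= c) ->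
  forall s, `|a s - b s| <= n%:R ^+ 2 * c.
Proof.
move=> Po aS bS h s.
have Po' := mulmx1C Po.
have mxB11 (X Y : 'M[R]_1) : (X - Y) 0 0 = X 0 0 - Y 0 0 by rewrite !mxE.
have mxD11 (X Y : 'M[R]_1) : (X + Y) 0 0 = X 0 0 + Y 0 0 by rewrite !mxE.
pose L (d : 'I_n -> R) := diag_mx (\row_i d i).
pose E := P^T *m L a *m P - L b.
have Ec i j : `|E i j| <= c.
  apply: le_trans (h i j); rewrite -/(L a).
  have Lb : L b i j = (i == j)%:R * b i by rewrite !mxE mulr_natl.
  have subE (X Y : 'M[R]_n) : (X - Y) i j = X i j - Y i j by rewrite !mxE.
  by rewrite /E subE Lb.
have Ldom (d : 'I_n -> R) (u : 'rV[R]_n) :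
    (forall i j : 'I_n, (i <= j)%N -> d j <= d i) ->
    (forall j : 'I_n, (j < s)%N -> u 0 j = 0) ->
    (u *m L d *m u^T) 0 0 <= d s * (u *m u^T) 0 0.
  move=> dS us; rewrite [in leRHS]mxE mxE mulr_sumr; apply: ler_sum => i _.
  rewrite mul_mx_diag !mxE mulrAC [leRHS]mulrC.
  have [is_|si] := ltnP i s; first by rewrite us // !mul0r.
  by apply: ler_wpM2l; [rewrite -expr2 sqr_ge0|exact: dS].
rewrite ler_norml lerBrDr lerBlDr; apply/andP; split.
- rewrite addrC lerBlDr.
  apply: (@eigenvalue_le _ _ P^T b s) => //; first by rewrite trmxK.
  move=> u us; rewrite trmxK -/(L b).
  have -> : P *m L b *m P^T = L a - P *m E *m P^T.
    have -> : L b = P^T *m L a *m P - E by rewrite /E opprB addrC subrK.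
    by rewrite mulmxBr mulmxBl !mulmxA Po' mul1mx -(mulmxA (L a)) Po' mulmx1.
  have := Ldom a u aS us; have := quad_form_bound (u *m P) Ec.
  rewrite trmx_mul !mulmxA -(mulmxA u P P^T) Po' mulmx1 ler_norml => /andP[h1 _] h2.
  rewrite mulmxBr mulmxBl !mulmxA mxB11; lra.
- apply: (@eigenvalue_le _ _ P a s) => // u us; rewrite -/(L a).
  have -> : P^T *m L a *m P = L b + E by rewrite /E addrC subrK.
  have := Ldom b u bS us; have := quad_form_bound u Ec.
  rewrite ler_norml => /andP[_ h1] h2.
  rewrite mulmxDr mulmxDl mxD11; lra.
Qed.

Lemma sort_perm (R : realDomainType) n (f : 'I_n -> R) :
  exists p : 'S_n, forall i j : 'I_n, (i <= j)%N -> f (p j) <= f (p i).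
Proof.
pose t := [tuple f i | i < n].
pose ss := sort >=%R t.
have /tuple_permP[p pE] : perm_eq ss t by rewrite perm_sort.
have sz : size ss = n by rewrite size_sort size_tuple.
exists p => i j ij.
have fE k : f (p k) = nth 0 ss k.
  by rewrite pE -tnth_nth !tnth_mktuple.
have tr : transitive (>=%R : rel R) by move=> a b c /= ba ac; exact: le_trans ac ba.
have rf : reflexive (>=%R : rel R) by move=> a; exact: lexx.
have srt : sorted >=%R ss by apply: sort_sorted => a b; exact: le_total.
rewrite !fE.
by apply: (sorted_leq_nth tr rf 0 srt _ _ _ _ ij); rewrite inE sz ltn_ord.
Qed.

(** Each difference of two of the polynomials keeps its sign on a common interval, so a permutation
    sorting the values at the single point [rr / 2] sorts them throughout. *)
Lemma sort_poly_near0 (R : realFieldType) n (b : 'I_n -> {poly R}) :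
  exists (p : 'S_n) (r : R), 0 < r /\ forall e, 0 < e < r ->
    forall i j : 'I_n, (i <= j)%N -> (b (p j)).[e] <= (b (p i)).[e].
Proof.
have /choice[r hr] := fun ij : 'I_n * 'I_n => poly_sign_near0 (b ij.1 - b ij.2).
pose rr := \big[Num.min/1]_ij r ij.
have rr0 : 0 < rr.
  by apply: (big_ind (fun x => 0 < x)) => // [x y x0 y0|i _]; [rewrite lt_min x0|case: (hr i)].
have rle ij : rr <= r ij by exact: bigmin_le.
have e10 : 0 < rr / 2 by rewrite divr_gt0.
have e1r : rr / 2 < rr by rewrite ltr_pdivrMr // mulr_natr mulr2n ltrDl.
have [p hp] := sort_perm (fun i => (b i).[rr / 2]).
exists p, rr; split=> // e /andP[e0 er] i j ij.
have [_ [h|h]] := hr (p i, p j).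
  have := h e; rewrite e0 (lt_le_trans er (rle _)) => /(_ isT).
  by rewrite hornerD hornerN subr_ge0.
have := h (rr / 2); rewrite e10 (lt_le_trans e1r (rle _)) => /(_ isT).
by rewrite hornerD hornerN subr_lt0 ltNge hp.
Qed.

(** * Eigenvalue expansions *)

Lemma near_right0P (R : realType) (Q : R -> Prop) :
  (exists r : R, 0 < r /\ forall e, 0 < e < r -> Q e) <-> \forall e \near 0^'+, Q e.
Proof.
split=> [[r [r0 h]]|].
  near=> e; apply: h; apply/andP; split; near: e.
  - exact: nbhs_right_gt.
  - exact: nbhs_right_lt.
case=> r /= r0 h; exists r; split=> // e /andP[e0 er]; apply: h => //=.
by rewrite sub0r normrN gtr0_norm.
Unshelve. all: by end_near. Qed.

Lemma orthogonal_entry_le1 (R : realFieldType) n (P : 'M[R]_n) i j :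
  P^T *m P = 1%:M -> `|P i j| <= 1.
Proof.
move=> /matrixP/(_ j j); rewrite !mxE eqxx => h.
rewrite -(@ler_pXn2r _ 2) ?nnegrE // real_normK ?num_real // expr1n -[leRHS]h.
rewrite (bigD1 i) //= mxE -expr2 lerDl sumr_ge0 // => k _.
by rewrite mxE -expr2 sqr_ge0.
Qed.

Lemma orthogonal_conj_bound (R : realFieldType) n (P X : 'M[R]_n) (c : R) i j :
  P^T *m P = 1%:M -> (forall k l, `|X k l| <= c) ->
  `|(P^T *m X *m P) i j| <= n%:R ^+ 2 * c.
Proof.
move=> Po Xc.
have -> : (P^T *m X *m P) i j = \sum_l \sum_k P k i * X k l * P l j.
  rewrite mxE; apply: eq_bigr => l _; rewrite mxE mulr_suml.
  by apply: eq_bigr => k _; rewrite mxE.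
apply: (le_trans (ler_norm_sum _ _ _)).
apply: (@le_trans _ _ (\sum_(l < n) \sum_(k < n) c)).
  apply: ler_sum => l _; apply: (le_trans (ler_norm_sum _ _ _)).
  apply: ler_sum => k _; rewrite !normrM.
  have c0 : 0 <= c by apply: le_trans (Xc k l); exact: normr_ge0.
  apply: (@le_trans _ _ (1 * c * 1)); last by rewrite mulr1 mul1r.
  apply: ler_pM; rewrite ?mulr_ge0 ?orthogonal_entry_le1 //.
  by apply: ler_pM; rewrite ?orthogonal_entry_le1.
by rewrite !sumr_const !card_ord -mulrnA -[leLHS]mulr_natl natrM expr2.
Qed.

Section EigenvalueExpansion.
Variables (R : realType) (n : nat) (A : R -> 'M[R]_n) (lam : R -> 'I_n -> R).
Hypotheses (A_analytic : forall i j, analytic_at0 (fun e => A e i j))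
  (A_sym : \forall e \near 0^'+, (A e)^T = A e)
  (A_eigs : \forall e \near 0^'+, sorted_eigs (A e) (lam e)).

Lemma poly_mx_approx N : exists (B : 'M[{poly R}]_n) (C : R), [/\ B^T = B, 0 <= C &
  \forall e \near 0^'+, forall i j, `|A e i j - (B i j).[e]| <= C * e ^+ N].
Proof.
have h (ij : 'I_n * 'I_n) : exists pC : {poly R} * R, 0 <= pC.2 /\
    \forall e \near 0^'+, `|A e ij.1 ij.2 - pC.1.[e]| <= pC.2 * e ^+ N.
  have [p [C [r [r0 C0 hp]]]] := analytic_trunc N (A_analytic ij.1 ij.2).
  exists (p, C); split=> //; apply/near_right0P; exists r; split=> // e /andP[e0 er].
  by have := hp e; rewrite (gtr0_norm e0) => /(_ er).
have {h}[pC hpC] := choice h.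
pose p i j := (pC (i, j)).1; pose C := \sum_ij (pC ij).2.
have C0 ij : 0 <= (pC ij).2 by case: (hpC ij).
have Cle ij : (pC ij).2 <= C by rewrite /C (bigD1 ij) //= lerDl sumr_ge0.
(* The entries are truncated independently; averaging with the transpose restores symmetry and keeps
   the error bound, because [A e] is symmetric. *)
exists (\matrix_(i, j) ((2^-1)%:P * (p i j + p j i))), C; split.
- by apply/matrixP => i j; rewrite !mxE addrC.
- exact: sumr_ge0.
have : \forall e \near 0^'+, forall ij, `|A e ij.1 ij.2 - (pC ij).1.[e]| <= (pC ij).2 * e ^+ N.
  by apply: filter_forall => ij; case: (hpC ij).
move=> hn; near=> e => i j.
have e0 : 0 < e by near: e; exact: nbhs_right_gt.
have As : (A e)^T = A e by near: e.
have h : forall ij, `|A e ij.1 ij.2 - (pC ij).1.[e]| <= (pC ij).2 * e ^+ N by near: e.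
have hC k l : `|A e k l - (p k l).[e]| <= C * e ^+ N.
  by apply: le_trans (h (k, l)) _; rewrite ler_wpM2r ?exprn_ge0 // ltW.
have Aji : A e j i = A e i j by rewrite -[in LHS]As mxE.
have := hC i j; have := hC j i; rewrite Aji mxE !hornerE.
by rewrite !ler_norml => /andP[h1 h2] /andP[h3 h4]; apply/andP; split; lra.
Unshelve. all: by end_near. Qed.

(** [A e] is replaced by a polynomial truncation, which is diagonalised modulo ['X^N]. Dividing [U]
    by [g] gives a truly orthogonal matrix at each small [e], and Weyl's inequality compares [lam]
    with the rescaled diagonal entries, taken in decreasing order. *)
Lemma eigenvalue_approx N : exists (b : 'I_n -> {poly R}) (g : {poly R}) (C : R),
  [/\ g.[0] = 1, 0 <= C & \forall e \near 0^'+, forall s,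
     `|lam e s - (b s).[e] / g.[e] ^+ 2| <= C * e ^+ N].
Proof.
have [B [C [Bs C0 hB]]] := poly_mx_approx N.
have [U [g [Uo g0 Ud]]] := poly_mx_diagonalization N Bs.
pose D := U^T *m B *m U.
have [p [r hp]] := sort_poly_near0 (fun i => D i i).
have {r}hp : \forall e \near 0^'+, forall i j : 'I_n, (i <= j)%N ->
    (D (p j) (p j)).[e] <= (D (p i) (p i)).[e].
  by apply/near_right0P; exists r.
have [Cq [Cq0 hq]] : exists Cq : R, 0 <= Cq /\ forall e i j, 0 <= e <= 1 -> i != j ->
    `|(D i j).[e]| <= Cq * e ^+ N.
  have h (ij : 'I_n * 'I_n) : exists c : R, 0 <= c /\ forall e, 0 <= e <= 1 ->
      ij.1 != ij.2 -> `|(D ij.1 ij.2).[e]| <= c * e ^+ N.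
    have [ij0|ijn] := eqVneq ij.1 ij.2; first by exists 0; split.
    have /dvdpP[q qE] := Ud _ _ ijn.
    have [c [c0 hc]] := poly_bounded q; exists c; split=> // e he _.
    rewrite /D qE hornerM hornerXn normrM.
    have /andP[e0 _] := he.
    by rewrite [`|e ^+ N|]ger0_norm ?exprn_ge0 // ler_wpM2r ?exprn_ge0 ?hc.
  have {h}[c hc] := choice h.
  have c0 ij : 0 <= c ij by case: (hc ij).
  exists (\sum_ij c ij); split; first exact: sumr_ge0.
  move=> e i j he ij; case: (hc (i, j)) => _ /(_ e he ij) /le_trans; apply.
  have /andP[e0 _] := he.
  by rewrite ler_wpM2r ?exprn_ge0 // (bigD1 (i, j)) //= lerDl sumr_ge0.
have gnear : \forall e \near 0^'+, 1 / 2 <= g.[e].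
  have [|r [r0 hr]] := @poly_near0 _ g (1 / 2); first by [].
  apply/near_right0P; exists r; split=> // e /andP[e0 er].
  have := hr e; rewrite (ltW e0) er g0 => /(_ isT).
  by rewrite ler_norml => /andP[h _]; lra.
(* [4 * Cq] accounts for the off-diagonal remainder, as [g^-2 <= 4], and [n^2 * C] for the
   conjugated truncation error. *)
pose c := 4 * Cq + n%:R ^+ 2 * C.
have c0 : 0 <= c by rewrite addr_ge0 // mulr_ge0 // exprn_ge0.
exists (fun s => D (p s) (p s)), g, (n%:R ^+ 2 * c); split=> //.
  by rewrite mulr_ge0 // exprn_ge0.
near=> e => s.
have e0 : 0 < e by near: e; exact: nbhs_right_gt.
have e1 : e < 1 by near: e; exact: nbhs_right_lt.
have ge : 1 / 2 <= g.[e] by near: e.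
have As : (A e)^T = A e by near: e.
have Ae : sorted_eigs (A e) (lam e) by near: e.
have Be : forall i j, `|A e i j - (B i j).[e]| <= C * e ^+ N by near: e.
have pe : forall i j : 'I_n, (i <= j)%N ->
    (D (p j) (p j)).[e] <= (D (p i) (p i)).[e] by near: e.
have g1 : 0 < g.[e] by apply: lt_le_trans ge; rewrite divr_gt0.
pose ev (M : 'M[{poly R}]_n) : 'M[R]_n := map_mx (horner_eval e) M.
pose O := g.[e]^-1 *: ev U.
have OT : O^T = g.[e]^-1 *: (ev U)^T by rewrite /O linearZ.
have Oo : O^T *m O = 1%:M.
  have UU : (ev U)^T *m ev U = (g.[e] ^+ 2)%:M.
    by rewrite /ev map_trmx -map_mxM Uo map_scalar_mx /= /horner_eval horner_exp.
  rewrite OT /O -scalemxAl -scalemxAr scalerA UU -scalemx1 scalerA -expr2.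
  by rewrite -exprMn mulVf ?gt_eqF // expr1n scale1r.
have OD : O^T *m ev B *m O = (g.[e] ^+ 2)^-1 *: ev D.
  have -> : ev D = (ev U)^T *m ev B *m ev U by rewrite /ev /D !map_mxM map_trmx.
  by rewrite OT /O -!scalemxAl -scalemxAr scalerA -expr2 exprVn.
have [P [Po AP]] := sorted_eigs_diagonalization As Ae.
(* Weyl's inequality needs the approximate eigenvalues in decreasing order, so the basis is permuted
   by [p]. *)
pose O' := O *m (perm_mx p)^T.
have pp : perm_mx p *m (perm_mx p)^T = 1%:M :> 'M[R]_n.
  by rewrite tr_perm_mx -perm_mxM mulgV perm_mx1.
have O'o : O'^T *m O' = 1%:M.
  by rewrite /O' trmx_mul trmxK mulmxA -(mulmxA (perm_mx p)) Oo mulmx1 pp.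
have conjp (M : 'M[R]_n) i j : (O'^T *m M *m O') i j = (O^T *m M *m O) (p i) (p j).
  rewrite /O' trmx_mul trmxK !mulmxA -!(mulmxA (perm_mx p)) tr_perm_mx.
  by rewrite -col_permE -row_permE !mxE.
rewrite -[n%:R ^+ 2 * c * _]mulrA.
apply: (@weyl_diag R n (P *m O') (lam e) (fun i => (D (p i) (p i)).[e] / g.[e] ^+ 2)).
- by rewrite trmx_mul mulmxA -(mulmxA O'^T) Po mulmx1.
- exact: (proj2 Ae).
- by move=> i j ij; rewrite ler_wpM2r ?invr_ge0 ?exprn_ge0 ?(ltW g1) ?pe.
move=> i j.
have -> : (P *m O')^T *m diag_mx (\row_k lam e k) *m (P *m O') = O'^T *m A e *m O'.
  by rewrite [in RHS]AP trmx_mul !mulmxA.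
rewrite conjp; set k := p i; set l := p j.
have -> : A e = ev B + (A e - ev B) by rewrite addrC subrK.
rewrite mulmxDr mulmxDl OD.
have -> : (i == j) = (k == l) by rewrite (inj_eq perm_inj).
have addE (X Y : 'M[R]_n) : (X + Y) k l = X k l + Y k l by rewrite mxE.
rewrite addE.
have h2 : `|(O^T *m (A e - ev B) *m O) k l| <= n%:R ^+ 2 * (C * e ^+ N).
  by apply: orthogonal_conj_bound => // a b; have := Be a b; rewrite !mxE.
rewrite addrAC; apply: le_trans (ler_normD _ _) _.
rewrite /c mulrDl -[n%:R ^+ 2 * C * _]mulrA; apply: lerD => //.
have Ek : ((g.[e] ^+ 2)^-1 *: ev D) k l = (D k l).[e] / g.[e] ^+ 2.
  by rewrite [LHS]mxE [ev D k l]mxE mulrC.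
rewrite Ek; have [kl|kl] := eqVneq k l.
  by rewrite kl mul1r subrr normr0 !mulr_ge0 ?exprn_ge0 // ltW.
rewrite mul0r subr0 normrM.
have g2 : `|(g.[e] ^+ 2)^-1| <= 4.
  rewrite ger0_norm ?invr_ge0 ?exprn_ge0 ?(ltW g1) //.
  rewrite -[4]invrK lef_pV2 ?posrE ?invr_gt0 ?exprn_gt0 //; nra.
have := hq e k l; rewrite (ltW e0) (ltW e1) => /(_ isT kl) hD.
rewrite mulrC -mulrA; exact: ler_pM.
Unshelve. all: by end_near. Qed.

(** With an approximation to order [m + 1], the bound [O(e^m)] forces ['X^m] to divide the numerator
    [b s]; since [g(0) = 1], the coefficient sought is the value at 0 of the quotient. *)
Lemma eigenvalue_expansion s m :
  (exists C : R, \forall e \near 0^'+, `|lam e s| <= C * e ^+ m) ->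
  exists l C : R, \forall e \near 0^'+, `|lam e s - e ^+ m * l| <= C * e ^+ m.+1.
Proof.
move=> [M hM].
have [b [g [C [g0 C0 hb]]]] := eigenvalue_approx m.+1.
have gnear : \forall e \near 0^'+, 1 / 2 <= g.[e] <= 2.
  have [|r [r0 hr]] := @poly_near0 _ g (1 / 2); first by [].
  apply/near_right0P; exists r; split=> // e /andP[e0 er].
  have := hr e; rewrite (ltW e0) er g0 => /(_ isT).
  by rewrite ler_norml => /andP[h1 h2]; apply/andP; split; lra.
have /dvdpP[h bE] : 'X^m %| b s.
  have : \forall e \near 0^'+, `|(b s).[e]| <= 4 * (`|M| + C) * e ^+ m.
    near=> e.
    have e0 : 0 < e by near: e; exact: nbhs_right_gt.
    have e1 : e < 1 by near: e; exact: nbhs_right_lt.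
    have /andP[ge ge'] : 1 / 2 <= g.[e] <= 2 by near: e.
    have Me : `|lam e s| <= M * e ^+ m by near: e.
    have /(_ s) be : forall s, `|lam e s - (b s).[e] / g.[e] ^+ 2| <= C * e ^+ m.+1 by near: e.
    have em : 0 <= e ^+ m by rewrite exprn_ge0 // ltW.
    have g2 : 0 < g.[e] ^+ 2 by rewrite exprn_gt0 //; lra.
    have -> : (b s).[e] = g.[e] ^+ 2 * ((b s).[e] / g.[e] ^+ 2).
      by rewrite mulrC divfK // gt_eqF.
    rewrite normrM (gtr0_norm g2) -mulrA; apply: ler_pM => //; first exact: ltW.
      by nra.
    have -> : (b s).[e] / g.[e] ^+ 2 = lam e s - (lam e s - (b s).[e] / g.[e] ^+ 2) by ring.
    apply: le_trans (ler_normB _ _) _; rewrite mulrDl; apply: lerD.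
      by apply: (le_trans Me); rewrite ler_wpM2r // ler_norm.
    by apply: (le_trans be); rewrite ler_wpM2l // exprS ler_piMl // ltW.
  move=> hn; have [r [r0 hr]] := (near_right0P _).2 hn.
  by apply: (@poly_dvdX_of_bound _ _ _ (4 * (`|M| + C)) r r0) => e; exact: hr.
(* Replacing [h / g^2] by the constant [h(0)] costs a multiple of [e], because the numerator of the
   difference vanishes at 0. *)
have [k kE] : exists k, h - h.[0]%:P * g ^+ 2 = k * 'X.
  have /dvdpP[k kE] : 'X %| h - h.[0]%:P * g ^+ 2.
    by rewrite dvdX_horner0 hornerD hornerN hornerM hornerC horner_exp g0 expr1n mulr1 subrr.
  by exists k.
have [K [K0 hK]] := poly_bounded k.
exists h.[0], (C + 4 * K); near=> e.
have e0 : 0 < e by near: e; exact: nbhs_right_gt.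
have e1 : e < 1 by near: e; exact: nbhs_right_lt.
have /andP[ge ge'] : 1 / 2 <= g.[e] <= 2 by near: e.
have /(_ s) be : forall s, `|lam e s - (b s).[e] / g.[e] ^+ 2| <= C * e ^+ m.+1 by near: e.
have g1 : 0 < g.[e] by lra.
have g2 : 0 < g.[e] ^+ 2 by rewrite exprn_gt0.
have -> : lam e s - e ^+ m * h.[0] =
    (lam e s - (b s).[e] / g.[e] ^+ 2) + e ^+ m.+1 * (k.[e] / g.[e] ^+ 2).
  have hE : h.[e] = h.[0] * g.[e] ^+ 2 + k.[e] * e.
    have := congr1 (fun p => p.[e]) kE; rewrite hornerM hornerX => <-.
    by rewrite hornerD hornerN hornerM hornerC horner_exp addrC subrK.
  rewrite bE hornerM hornerXn hE [e ^+ m.+1]exprS.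
  by field; rewrite gt_eqF.
apply: le_trans (ler_normD _ _) _; rewrite mulrDl; apply: lerD => //.
have em : 0 <= e ^+ m.+1 by rewrite exprn_ge0 // ltW.
rewrite normrM (ger0_norm em) mulrC ler_wpM2r // normrM mulrC.
apply: ler_pM => //; last by apply: hK; rewrite !ltW.
rewrite ger0_norm ?invr_ge0 ?(ltW g2) //.
rewrite -[4]invrK lef_pV2 ?posrE ?invr_gt0 //; nra.
Unshelve. all: by end_near. Qed.

End EigenvalueExpansion.

(** * Products of leading coefficients *)

Lemma cvg_exprn_right0 (R : realType) k : (0 < k)%N -> e ^+ k @[e --> (0 : R)^'+] --> 0.
Proof.
move=> k0; apply: cvg_at_right_filter.
by have := @exprn_continuous R k 0; rewrite /continuous_at expr0n gtn_eqF.
Qed.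

(* Both sides are limits of [det (1 + e ^ - (2 s + 1) B(e))], with the columns up
   to [s] rescaled so that the diverging factors become bounded. *)
Lemma leading_eigenvalue_product (R : realType) n (B : R -> 'M[R]_n)
    (lam : R -> 'I_n -> R) (M : 'M[R]_n) (l : 'I_n -> R) (s : 'I_n) :
  (forall i j, B e i j / e ^+ (i + j) @[e --> 0^'+] --> M i j) ->
  (forall i, lam e i / e ^+ (2 * i) @[e --> 0^'+] --> l i) ->
  (\forall e \near 0^'+, exists Q : 'M[R]_n,
     Q^T *m Q = 1%:M /\ B e = Q^T *m diag_mx (\row_i lam e i) *m Q) ->
  \det (\matrix_(i, j) if (j <= s)%N then M i j else (i == j)%:R) =
  \prod_(i < n | (i <= s)%N) l i.
Proof.
move=> BM laml diagB.
(* With [D = diag(e^i)] and [c = e^-(2 s + 1)], [N e] is [D^-1 (1 + c B) D] with its columns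
   [j <= s] multiplied by [e^(2 s + 1 - 2 j)], and [f i] is [1 + c lam_i] scaled likewise. The odd
   exponent lies strictly between [2 s] and [2 (s + 1)], so the powers of [e] left outside the
   convergent quotients are all positive. *)
pose N e : 'M[R]_n := \matrix_(i, j)
  if (j <= s)%N then (i == j)%:R * e ^+ ((2 * s).+1 - 2 * j) + B e i j / e ^+ (i + j)
  else (i == j)%:R + e ^+ (2 * j - (2 * s).+1) * (B e i j / e ^+ (i + j)).
pose f (i : 'I_n) (e : R) := if (i <= s)%N then e ^+ ((2 * s).+1 - 2 * i) + lam e i / e ^+ (2 * i)
  else 1 + e ^+ (2 * i - (2 * s).+1) * (lam e i / e ^+ (2 * i)).
have c1 (u : R -> R) (b q : R) k : (0 < k)%N -> u e @[e --> 0^'+] --> q ->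
    b * e ^+ k + u e @[e --> 0^'+] --> q.
  move=> k0 uq; have : b * e ^+ k + u e @[e --> 0^'+] --> b * 0 + q.
    by apply: cvgD => //; apply: cvgM; [exact: cvg_cst|exact: cvg_exprn_right0].
  by rewrite mulr0 add0r.
have c2 (u : R -> R) (b q : R) k : (0 < k)%N -> u e @[e --> 0^'+] --> q ->
    b + e ^+ k * u e @[e --> 0^'+] --> b.
  move=> k0 uq; have : b + e ^+ k * u e @[e --> 0^'+] --> b + 0 * q.
    apply: cvgD; first exact: cvg_cst.
    by apply: cvgM => //; exact: cvg_exprn_right0.
  by rewrite mul0r addr0.
have Nlim : \det (N e) @[e --> 0^'+] -->
    \det (\matrix_(i, j) if (j <= s)%N then M i j else (i == j)%:R).
  apply: cvg_det => i j; rewrite mxE; under eq_fun do rewrite mxE.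
  have [js|sj] := leqP j s.
  - by apply: c1; [lia|exact: BM].
  - by apply: c2 (BM i j); lia.
have flim : \prod_(i < n) f i e @[e --> 0^'+] -->
    \prod_(i < n) (if (i <= s)%N then l i else 1).
  apply: cvg_prod => i; rewrite /f; case: leqP => [i_s|si].
  - have := @c1 _ 1 _ ((2 * s).+1 - 2 * i)%N _ (laml i).
    by under eq_fun do rewrite mul1r; apply; lia.
  - by apply: c2 (laml i); lia.
rewrite [RHS]big_mkcond /=; apply: (cvg_unique _ Nlim) => //.
have: \forall e \near 0^'+, \prod_(i < n) f i e = \det (N e).
  near=> e.
  have e0 : 0 < e by near: e; exact: nbhs_right_gt.
  have [Q [Qo BQ]] : exists Q : 'M[R]_n,
     Q^T *m Q = 1%:M /\ B e = Q^T *m diag_mx (\row_i lam e i) *m Q by near: e.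
  have ek k : e ^+ k != 0 by rewrite expf_neq0 // gt_eqF.
  pose c := (e ^+ (2 * s).+1)^-1.
  pose t (i : 'I_n) := if (i <= s)%N then e ^+ ((2 * s).+1 - 2 * i) else 1.
  have cle (i : 'I_n) : (i <= s)%N -> c = (e ^+ i * e ^+ i * e ^+ ((2 * s).+1 - 2 * i))^-1.
    by move=> i_s; rewrite /c -!exprD; congr (_ ^+ _)^-1; lia.
  have clt (i : 'I_n) : (s < i)%N -> c = e ^+ (2 * i - (2 * s).+1) / (e ^+ i * e ^+ i).
    move=> si; have -> : e ^+ i * e ^+ i = e ^+ (2 * i - (2 * s).+1) * e ^+ (2 * s).+1.
      by rewrite -!exprD; congr (_ ^+ _); lia.
    by rewrite invfM mulrA divff ?mul1r.
  have e2 (i : 'I_n) : e ^+ (2 * i) = e ^+ i * e ^+ i by rewrite mul2n -addnn exprD.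
  pose D := diag_mx (\row_(i < n) e ^+ i).
  have DN : D *m N e = (1%:M + c *: B e) *m diag_mx (\row_(i < n) (e ^+ i * t i)).
    apply/matrixP => i j; rewrite mul_diag_mx mul_mx_diag !mxE /t exprD.
    rewrite -[1 *+ (i == j)]/((i == j)%:R).
    case: leqP => [js|sj]; [rewrite (cle j js)|rewrite (clt j sj)];
      case: eqP => [->|_]; rewrite ?mulr1n ?mulr0n; field; rewrite ?ek //.
  have detD : \det D != 0.
    by rewrite det_diag; apply/prodf_neq0 => i _; rewrite mxE.
  apply: (mulfI detD); rewrite -det_mulmx DN det_mulmx det_diag.
  have -> : \det (1%:M + c *: B e) = \prod_i (1 + c * lam e i).
    have -> : 1%:M + c *: B e = Q^T *m diag_mx (\row_i (1 + c * lam e i)) *m Q.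
      have -> : diag_mx (\row_i (1 + c * lam e i)) = 1%:M + c *: diag_mx (\row_i lam e i).
        by apply/matrixP => i j; rewrite !mxE; case: eqP; rewrite ?mulr1n ?mulr0n ?mulr0 ?addr0.
      by rewrite mulmxDr mulmxDl mulmx1 Qo BQ -scalemxAr -scalemxAl.
    rewrite !det_mulmx mulrAC -det_mulmx Qo det1 mul1r det_diag.
    by apply: eq_bigr => i _; rewrite mxE.
  rewrite det_diag -!big_split /=; apply: eq_bigr => i _; rewrite !mxE /f /t e2.
  by case: leqP => [i_s|si]; [rewrite (cle i i_s)|rewrite (clt i si)];
    field; rewrite ?ek.
move=> fN; apply: cvg_trans flim; apply: near_eq_cvg.
by apply: filterS fN => e ->.
Unshelve. all: by end_near. Qed.

(** * Orders of the eigenvalues and product formula for the kernel matrices *)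

Theorem theorem4p2 (R : realType) (n : nat) (a : R) (K : R -> R -> R)
    (x : 'I_n -> R) :
  0 < a -> Cll n a K ->
  (exists e0 : R, 0 < e0 /\ forall e : R, 0 <= e <= e0 -> psd (Keps K x e)) ->
  (forall i j : 'I_n, analytic_at0 (fun e => Keps K x e i j)) ->
  forall lam : R -> 'I_n -> R,
  (exists d : R, 0 < d /\ forall e : R, 0 < e < d -> sorted_eigs (Keps K x e) (lam e)) ->
  exists lt : 'I_n -> R,
    (forall s : 'I_n, exists C d : R, 0 < d /\ forall e : R, 0 < e < d ->
        `|lam e s - e ^+ (2 * s) * lt s| <= C * e ^+ (2 * s).+1) /\
    (forall s : 'I_n,
        \prod_(k < n | (k <= s)%N) lt k =
        \det ((Vand x s)^T *m Vand x s) * \det (Wronskian K s)).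
Proof.
move=> a0 CK [e0 [e00 Kpsd]] Kan lam /near_right0P eigs.
have psdK : \forall e \near 0^'+, psd (Keps K x e).
  apply/near_right0P; exists e0; split=> // e /andP[h1 h2].
  by apply: Kpsd; rewrite !ltW.
have symK : \forall e \near 0^'+, (Keps K x e)^T = Keps K x e.
  by apply: filterS psdK => e [].
have [P [Po Ptri]] := orthogonal_triangularize (\matrix_(i < n, j < n) x i ^+ j).
have Po' := mulmx1C Po.
pose r i := \sum_k P i k * x k ^+ i.
have Pann (i : 'I_n) k : (k < i)%N -> \sum_l P i l * x l ^+ k = 0.
  move=> ki; have kn : (k < n)%N by exact: ltn_trans ki (ltn_ord i).
  rewrite -[RHS](Ptri i (Ordinal kn) ki) mxE.
  by apply: eq_bigr => l _; rewrite mxE.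
pose B e := P *m Keps K x e *m P^T.
have BE e i j : B e i j = \sum_l P j l * (\sum_k P i k * K (e * x k) (e * x l)).
  rewrite /B mxE; apply: eq_bigr => l _; rewrite !mxE mulrC; congr (_ * _).
  by apply: eq_bigr => k _; rewrite !mxE.
pose W i j : R := pderiv K i j 0 0 / (i`!%:R * j`!%:R).
pose M : 'M[R]_n := \matrix_(i, j) (r i * r j * W i j).
have Blim i j : B e i j / e ^+ (i + j) @[e --> 0^'+] --> M i j.
  apply/cvgrPdist_le => d d0.
  have [q [q0 hq]] := mixed_taylor_approx a0 CK (ltnW (ltn_ord i)) (ltnW (ltn_ord j))
    (Pann i) (Pann j) d0.
  apply/near_right0P; exists q; split=> // e he.
  have /andP[ep _] := he.
  have ek : 0 < e ^+ (i + j) by rewrite exprn_gt0.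
  rewrite -(ler_pM2r ek) -[X in _ * X <= _](gtr0_norm ek) -normrM mulrBl divfK ?gt_eqF //.
  by rewrite distrC [M i j * _]mulrC BE mxE; exact: hq.
have Beig : \forall e \near 0^'+, exists Q : 'M[R]_n,
    Q^T *m Q = 1%:M /\ B e = Q^T *m diag_mx (\row_i lam e i) *m Q.
  near=> e.
  have Ks : (Keps K x e)^T = Keps K x e by near: e.
  have Ke : sorted_eigs (Keps K x e) (lam e) by near: e.
  have [Q [Qo KQ]] := sorted_eigs_diagonalization Ks Ke.
  exists (Q *m P^T); split.
    by rewrite trmx_mul trmxK mulmxA -(mulmxA P) Qo mulmx1.
  by rewrite /B KQ trmx_mul trmxK !mulmxA.
have lam_ge0 : \forall e \near 0^'+, forall s, 0 <= lam e s.
  near=> e => s.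
  have Ks : (Keps K x e)^T = Keps K x e by near: e.
  have Ke : sorted_eigs (Keps K x e) (lam e) by near: e.
  have [Q [Qo KQ]] := sorted_eigs_diagonalization Ks Ke.
  have Qo' := mulmx1C Qo.
  have [_ /(_ (Q^T *m delta_mx s 0))] : psd (Keps K x e) by near: e.
  rewrite KQ trmx_mul trmxK !mulmxA -(mulmxA _ Q Q^T) Qo' mulmx1.
  rewrite -(mulmxA _ Q Q^T) Qo' mulmx1 trmx_delta -rowE -colE !mxE eqxx mulr1n.
  by [].
clearbody B.
(* By Courant-Fischer only the block of [B] with indices at least [s] matters; its entries are
   [O(e^(i + j))], hence [O(e^(2 s))]. Nonnegativity of the eigenvalues turns the upper bound into
   one on [|lam_s|]. *)
have lam_le s : exists C : R, \forall e \near 0^'+, `|lam e s| <= C * e ^+ (2 * s).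
  pose C := \sum_(ij : 'I_n * 'I_n) (`|M ij.1 ij.2| + 1).
  have C0 : 0 <= C by apply: sumr_ge0 => ij _; rewrite addr_ge0.
  have Bb : \forall e \near 0^'+, forall ij : 'I_n * 'I_n,
      `|B e ij.1 ij.2| <= C * e ^+ (ij.1 + ij.2).
    apply: filter_forall => -[i j] /=.
    have /cvgrPdist_le/(_ 1 ltr01) h := Blim i j.
    near=> e.
    have ep : 0 < e by near: e; exact: nbhs_right_gt.
    have ek : 0 < e ^+ (i + j) by rewrite exprn_gt0.
    have he : `|M i j - B e i j / e ^+ (i + j)| <= 1 by near: e.
    rewrite -ler_pdivrMr // -[X in _ / X](gtr0_norm ek) -normfV -normrM.
    apply: (@le_trans _ _ (`|M i j| + 1)).
      have := ler_distD (M i j) (B e i j / e ^+ (i + j)) 0.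
      rewrite !subr0 distrC => /le_trans; apply; rewrite addrC lerD2l.
      by [].
    by rewrite /C (bigD1 (i, j)) //= lerDl sumr_ge0 // => ij _; rewrite addr_ge0.
  exists (n%:R ^+ 2 * C); near=> e.
  have ep : 0 < e by near: e; exact: nbhs_right_gt.
  have e1 : e < 1 by near: e; exact: nbhs_right_lt.
  have l0 : forall s, 0 <= lam e s by near: e.
  have Be : forall ij : 'I_n * 'I_n, `|B e ij.1 ij.2| <= C * e ^+ (ij.1 + ij.2) by near: e.
  have [Q [Qo BQ]] : exists Q : 'M[R]_n,
    Q^T *m Q = 1%:M /\ B e = Q^T *m diag_mx (\row_i lam e i) *m Q by near: e.
  have [_ srt] : sorted_eigs (Keps K x e) (lam e) by near: e.
  rewrite ger0_norm //; apply: (eigenvalue_le Qo srt) => u us; rewrite -BQ.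
  pose E : 'M[R]_n := \matrix_(i, j) if (s <= i)%N && (s <= j)%N then B e i j else 0.
  have -> : u *m B e *m u^T = u *m E *m u^T.
    apply/matrixP => p q; rewrite !mxE; apply: eq_bigr => j _; rewrite !mxE !ord1.
    have [sj|js] := leqP s j; last by rewrite us ?mulr0.
    congr (_ * _); apply: eq_bigr => i _; rewrite !mxE ?sj andbT.
    by have [si|i_s] := leqP s i; [|rewrite us ?mul0r].
  apply: le_trans (ler_norm _) _; rewrite -[n%:R ^+ 2 * C * _]mulrA.
  apply: quad_form_bound => i j; rewrite mxE; case: ifP => [/andP[si sj]|_]; last first.
    by rewrite normr0 mulr_ge0 ?exprn_ge0 // ltW.
  apply: (le_trans (Be (i, j))); rewrite ler_wpM2l //= ler_wiXn2l ?ltW //.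
  by rewrite mul2n -addnn leq_add.
have expansion s := eigenvalue_expansion Kan symK eigs (lam_le s).
have [l hl] := choice expansion.
exists l; split=> [s|s].
  by have [C hC] := hl s; exists C; apply/near_right0P.
have laml i : lam e i / e ^+ (2 * i) @[e --> 0^'+] --> l i.
  have [C hC] := hl i.
  apply/cvgrPdist_le => d d0; near=> e.
  have ep : 0 < e by near: e; exact: nbhs_right_gt.
  have ek : 0 < e ^+ (2 * i) by rewrite exprn_gt0.
  have he : `|lam e i - e ^+ (2 * i) * l i| <= C * e ^+ (2 * i).+1 by near: e.
  have ed : e < d / (`|C| + 1).
    by near: e; apply: nbhs_right_lt; rewrite divr_gt0 // ltr_wpDl.
  rewrite -(ler_pM2r ek) -[X in _ * X <= _](gtr0_norm ek) -normrM mulrBl divfK ?gt_eqF //.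
  rewrite distrC [l i * _]mulrC; apply: (le_trans he).
  rewrite exprS mulrA ler_wpM2r ?(ltW ek) //.
  move: ed; rewrite ltr_pdivlMr ?ltr_wpDl // => ed.
  have := ler_norm C; have : 0 <= `|C| by []. nra.
rewrite -(leading_eigenvalue_product s Blim laml Beig).
(* Multiplying by the orthogonal [P] does not change the Gram matrix of the Vandermonde columns, and
   makes them triangular with diagonal [r]. *)
pose T := P *m Vand x s.
have Ttri (i : 'I_n) (j : 'I_s.+1) : (j < i)%N -> T i j = 0.
  move=> ji; rewrite -[RHS](Pann i j ji) mxE.
  by apply: eq_bigr => k _; rewrite mxE.
have Tdiag (i : 'I_n) (j : 'I_s.+1) : i = j :> nat -> T i j = r i.
  by move=> ij; rewrite /r mxE ij; apply: eq_bigr => k _; rewrite mxE.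
have -> : (Vand x s)^T *m Vand x s = T^T *m T.
  by rewrite /T trmx_mul mulmxA -(mulmxA _ P^T) Po mulmx1.
rewrite (det_gram_triangular Ttri Tdiag).
pose r' (i : 'I_s.+1) := r (widen_ord (ltn_ord s) i).
have rr' (i : 'I_n) (j : 'I_s.+1) : i = j :> nat -> r i = r' j.
  by move=> ij; rewrite /r'; congr r; apply: val_inj.
rewrite (prod_leq_ord rr').
pose D := diag_mx (\row_i r' i).
(* The leading block of [M] is [D W D]: the diagonal scaling enters once from each side, which
   matches the square in the Gram determinant. *)
have -> : (\prod_j r' j) ^+ 2 * \det (Wronskian K s) = \det (D *m Wronskian K s *m D).
  have -> : \prod_j r' j = \det D by rewrite det_diag; apply: eq_bigr => i _; rewrite mxE.
  by rewrite !det_mulmx expr2 mulrAC.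
apply: det_leading => [i j sj|i j i' j' ii jj]; first by rewrite mxE leqNgt sj.
rewrite mxE jj -ltnS ltn_ord mul_mx_diag mul_diag_mx !mxE.
by rewrite (rr' i i' ii) (rr' j j' jj) /W ii jj mulrAC.
Unshelve. all: by end_near. Qed.
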